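(* Let $K$ be a field, let $m \geq 2$ be an integer, and assume that $K$ contains a primitive $m$-th root of unity $q$. Let $k, l, n$ be positive integers with $k^l \equiv 1 \pmod n$, and let $D_{ln}^k = \langle c, d \mid c^l = 1,\ d^n = 1,\ cd = d^k c\rangle$. (1) There exists a bijection between the set of all matched pairs of Hopf algebras $(T_{m^2}(q), K[D_{ln}^k], \triangleleft, \triangleright)$ and the set $U_l(K) \times U_{(n,\,k-1)}(K)$ such that the matched pair $(\triangleleft, \triangleright)$ corresponding to $(\beta, \sigma) \in U_l(K) \times U_{(n,\,k-1)}(K)$ is given by $$d^t c^i \triangleright h^{j'} x^j = \beta^{ij}\, \sigma^{tj}\, h^{j'} x^j, \qquad d^t c^i \triangleleft h^{j'} x^j = d^t c^i\, \varepsilon(h^{j'} x^j)$$ for all $t = 0, \dots, n-1$, $i = 0, \dots, l-1$ and $j, j' = 0, \dots, m-1$. (2) Any bicrossed product between $T_{m^2}(q)$ and $K[D_{ln}^k]$ (that is, any $T_{m^2}(q) \bowtie K[D_{ln}^k]$ associated to such a matched pair) is isomorphic as a Hopf algebra to $T_{lnm^2}^{\beta,\sigma}(q)$ for some $(\beta, \sigma) \in U_l(K) \times U_{(n,\,k-1)}(K)$, where $T_{lnm^2}^{\beta,\sigma}(q)$ is the Hopf algebra generated as an algebra by $c, d, h, x$ subject to the relations $$c^l = d^n = h^m = 1, \quad x^m = 0, \quad ch = hc, \quad dh = hd, \quad cd = d^k c,$$ $$cx = \beta\, xc, \quad dx = \sigma\, xd, \quad xh = q\, hx,$$ with coalgebra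 structure and antipode given by $$\Delta(c) = c \otimes c, \quad \Delta(d) = d \otimes d, \quad \Delta(h) = h \otimes h, \quad \Delta(x) = x \otimes h + 1 \otimes x,$$ $$\varepsilon(c) = \varepsilon(d) = \varepsilon(h) = 1, \quad \varepsilon(x) = 0,$$ $$S(h) = h^{m-1}, \quad S(x) = -x h^{m-1}, \quad S(c) = c^{l-1}, \quad S(d) = d^{n-1}.$$
   Context: All algebras, coalgebras, Hopf algebras and tensor products are over $K$. Sweedler notation $\Delta(y) = y_{(1)} \otimes y_{(2)}$ is used (summation understood). For a positive integer $r$, $U_r(K)$ is the group of $r$-th roots of unity in $K$; a primitive $m$-th root of unity is a generator of $U_m(K)$ when $|U_m(K)| = m$. $(a,b)$ denotes the greatest common divisor (so $(n,0) = n$). $K[G]$ denotes the group Hopf algebra of a group $G$. The group $D_{ln}^k$ is a semidirect product of the cyclic groups $C_n = \langle d\rangle$ and $C_l = \langle c \rangle$; its elements are uniquely $d^t c^i$ with $0 \leq t \leq n-1$, $0 \leq i \leq l-1$. Taft algebra: $T_{m^2}(q)$ is the Hopf algebra generated as an algebra by $h$ and $x$ subject to $h^m = 1$, $x^m = 0$, $xh = q\,hx$, with $\Delta(h) = h \otimes h$, $\Delta(x) = x \otimes h + 1 \otimes x$, $\varepsilon(h) = 1$, $\varepsilon(x) = 0$. The elements $h^i x^j$, $0 \leq i, j \leq m-1$, form a $K$-basis. Matched pair of Hopf algebras: a quadruple $(A, H, \triangleleft, \triangleright)$ where $A$, $H$ are Hopf algebras and $\triangleleft : H \otimes A \to H$,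 $\triangleright : H \otimes A \to A$ are linear maps such that $(A, \triangleright)$ is a left $H$-module coalgebra, $(H, \triangleleft)$ is a right $A$-module coalgebra, and for all $a, b \in A$, $y, z \in H$: $$y \triangleright 1_A = \varepsilon_H(y) 1_A, \qquad 1_H \triangleleft a = \varepsilon_A(a) 1_H,$$ $$y \triangleright (ab) = (y_{(1)} \triangleright a_{(1)}) \bigl( (y_{(2)} \triangleleft a_{(2)}) \triangleright b \bigr),$$ $$(yz) \triangleleft a = \bigl( y \triangleleft (z_{(1)} \triangleright a_{(1)}) \bigr) (z_{(2)} \triangleleft a_{(2)}),$$ $$y_{(1)} \triangleleft a_{(1)} \otimes y_{(2)} \triangleright a_{(2)} = y_{(2)} \triangleleft a_{(2)} \otimes y_{(1)} \triangleright a_{(1)}.$$ Bicrossed product: the Hopf algebra $A \bowtie H$ associated to a matched pair is the tensor coalgebra $A \otimes H$ (with $a \otimes y$ written $a \bowtie y$) with unit $1_A \bowtie 1_H$, multiplication $(a \bowtie y)(b \bowtie z) = a\,(y_{(1)} \triangleright b_{(1)}) \bowtie (y_{(2)} \triangleleft b_{(2)})\, z$ and antipode $S(a \bowtie y) = S_H(y_{(2)}) \triangleright S_A(a_{(2)}) \bowtie S_H(y_{(1)}) \triangleleft S_A(a_{(1)})$. *)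

(* Defs.v *)
From HB Require Import structures.
From mathcomp Require Import all_boot all_order all_algebra all_fingroup all_field.
From mathcomp Require Import finmap.
From mathcomp.multinomials Require Import monalg.

Set Implicit Arguments.
Unset Strict Implicit.
Unset Printing Implicit Defensive.

Import GRing.Theory.

Local Open Scope ring_scope.

Reserved Notation "u \ox v" (at level 40, left associativity).
Reserved Notation "\tsum_ ( a , b <- t ) E"
  (at level 41, E at level 41, a name, b name,
   format "'[' \tsum_ ( a ,  b  <-  t ) '/  '  E ']'").

(* All spaces below are finite dimensional, so U (x) V is modelled by the
   matrices of coordinates on the products of the basis vectors of U and V. *)
Definition tensor (K : fieldType) (U V : vectType K) : vectType K :=
  'M[K]_(\dim {:U}, \dim {:V}).

Notation "U \ox V" := (tensor U V) : type_scope.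

Section Tensor.
Context {K : fieldType} {U V : vectType K}.

Definition tens (u : U) (v : V) : (U \ox V)%type := 
  \matrix_(i, j) (coord (vbasis {:U}) i u * coord (vbasis {:V}) j v).

(* For f bilinear, tlift f is the linear map with tlift f (u (x) v) = f u v
   (lemma tlift_tens); it is used to write sums in Sweedler notation. *)
Definition tlift {W : vectType K} (f : U -> V -> W) (t : (U \ox V)%type) : W :=
  \sum_i \sum_j
    (t : 'M_(_, _)) i j *: f (vbasis {:U})`_i (vbasis {:V})`_j.

End Tensor.

Notation "u \ox v" := (tens u v) : ring_scope.
Notation "\tsum_ ( a , b <- t ) E" := (tlift (fun a b => E) t) : ring_scope.

Section TensorTheory.
Context {K : fieldType} {U V W : vectType K}.

Lemma tlift_is_linear (f : U -> V -> W) : linear (tlift f).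
Proof.
move=> a s t; rewrite /tlift scaler_sumr -big_split; apply: eq_bigr => i _ /=.
rewrite scaler_sumr -big_split; apply: eq_bigr => j _ /=.
by rewrite !mxE scalerDl scalerA.
Qed.

HB.instance Definition _ f :=
  GRing.isLinear.Build K (U \ox V)%type W *:%R (tlift f) (tlift_is_linear f).

Lemma tensDl (u u' : U) (v : V) : (u + u') \ox v = u \ox v + u' \ox v.
Proof. by apply/matrixP=> i j; rewrite !mxE linearD mulrDl. Qed.

Lemma tensDr (u : U) (v v' : V) : u \ox (v + v') = u \ox v + u \ox v'.
Proof. by apply/matrixP=> i j; rewrite !mxE linearD mulrDr. Qed.

Lemma tensZl a (u : U) (v : V) : (a *: u) \ox v = a *: (u \ox v).
Proof. by apply/matrixP=> i j; rewrite !mxE linearZ mulrA. Qed.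

Lemma tensZr a (u : U) (v : V) : u \ox (a *: v) = a *: (u \ox v).
Proof. by apply/matrixP=> i j; rewrite !mxE linearZ /= mulrCA. Qed.

Lemma tlift_tens (f : U -> V -> W) u v :
    (forall v, linear (f^~ v)) -> (forall u, linear (f u)) ->
  \tsum_(a, b <- u \ox v) f a b = f u v.
Proof.
move=> fl fr.
pose Fl v := HB.pack_for {linear U -> W} (f^~ v)
  (GRing.isLinear.Build K U W *:%R (f^~ v) (fl v)).
pose Fr u := HB.pack_for {linear V -> W} (f u)
  (GRing.isLinear.Build K V W *:%R (f u) (fr u)).
rewrite {2}(coord_vbasis (memvf u)) -[RHS]/(Fl v _) linear_sum.
apply: eq_bigr => i _; rewrite linearZ /= -[f _ v]/(Fr _ v).
rewrite {2}(coord_vbasis (memvf v)) linear_sum scaler_sumr.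
by apply: eq_bigr => j _; rewrite linearZ scalerA !mxE.
Qed.

Lemma eq_tlift (f g : U -> V -> W) : f =2 g -> tlift f =1 tlift g.
Proof.
by move=> fg t; apply: eq_bigr => i _; apply: eq_bigr => j _; rewrite fg.
Qed.

Lemma tlift_funP a (f g : U -> V -> W) t :
  \tsum_(u, v <- t) (a *: f u v + g u v) = a *: tlift f t + tlift g t.
Proof.
rewrite /tlift scaler_sumr -big_split; apply: eq_bigr => i _ /=.
rewrite scaler_sumr -big_split; apply: eq_bigr => j _ /=.
by rewrite scalerDr !scalerA mulrC.
Qed.

End TensorTheory.

HB.mixin Record Vector_isCoalgebra (K : fieldType) C of Vector K C := {
  comul : {linear C -> (C \ox C)%type};
  counit : {scalar C};
  comulA : forall y : C,
    \tsum_(y1, y2 <- comul y) \tsum_(y11, y12 <- comul y1)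
      (y11 \ox (y12 \ox y2)) =
    \tsum_(y1, y2 <- comul y) (y1 \ox comul y2);
  counitl : forall y : C, \tsum_(y1, y2 <- comul y) counit y1 *: y2 = y;
  counitr : forall y : C, \tsum_(y1, y2 <- comul y) counit y2 *: y1 = y
}.

#[short(type="coalgType")]
HB.structure Definition Coalgebra (K : fieldType) :=
  { C of Vector_isCoalgebra K C & Vector K C }.

Section TensorAlgebra.
Context {K : fieldType} {A B : falgType K}.

Definition tmul (s t : (A \ox B)%type) : (A \ox B)%type :=
  \tsum_(a, b <- s) \tsum_(a', b' <- t) ((a * a') \ox (b * b')).

End TensorAlgebra.

HB.mixin Record FalgCoalg_isHopfAlgebra (K : fieldType) A
    of Falgebra K A & Coalgebra K A := {
  antipode : {linear A -> A};
  comul1 : comul (1 : A) = 1 \ox 1;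
  comulM : forall a b : A, comul (a * b) = tmul (comul a) (comul b);
  counit1 : counit (1 : A) = 1;
  counitM : forall a b : A, counit (a * b) = counit a * counit b;
  antipodel : forall a : A,
    \tsum_(a1, a2 <- comul a) (antipode a1 * a2) = counit a *: 1;
  antipoder : forall a : A,
    \tsum_(a1, a2 <- comul a) (a1 * antipode a2) = counit a *: 1
}.

#[short(type="hopfAlgType")]
HB.structure Definition HopfAlgebra (K : fieldType) :=
  { A of FalgCoalg_isHopfAlgebra K A & Falgebra K A & Coalgebra K A }.

Section MatchedPair.
Context {K : fieldType} (A H : hopfAlgType K).

(* is_left_module_coalgebra and is_right_module_coalgebra unfold "module whose
   structure map is a morphism of coalgebras". *)
Definition is_left_module_coalgebra (lact : 'Hom((H \ox A)%type, A)) : Prop :=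
  [/\ forall a : A, lact (1 \ox a) = a,
      forall (y z : H) (a : A), lact ((y * z) \ox a) = lact (y \ox lact (z \ox a)),
      forall (y : H) (a : A), comul (lact (y \ox a)) =
        \tsum_(y1, y2 <- comul y) \tsum_(a1, a2 <- comul a)
          (lact (y1 \ox a1) \ox lact (y2 \ox a2))
    & forall (y : H) (a : A), counit (lact (y \ox a)) = counit y * counit a].

Definition is_right_module_coalgebra (ract : 'Hom((H \ox A)%type, H)) : Prop :=
  [/\ forall y : H, ract (y \ox 1) = y,
      forall (y : H) (a b : A), ract (y \ox (a * b)) = ract (ract (y \ox a) \ox b),
      forall (y : H) (a : A), comul (ract (y \ox a)) =
        \tsum_(y1, y2 <- comul y) \tsum_(a1, a2 <- comul a)
          (ract (y1 \ox a1) \ox ract (y2 \ox a2))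
    & forall (y : H) (a : A), counit (ract (y \ox a)) = counit y * counit a].

Record matchedPair := MatchedPair {
  mp_ract : 'Hom((H \ox A)%type, H);
  mp_lact : 'Hom((H \ox A)%type, A);
  mp_lmodcoalg : is_left_module_coalgebra mp_lact;
  mp_rmodcoalg : is_right_module_coalgebra mp_ract;
  mp_lact1 : forall y : H, mp_lact (y \ox 1) = counit y *: 1;
  mp_ract1 : forall a : A, mp_ract (1 \ox a) = counit a *: 1;
  mp_lactM : forall (y : H) (a b : A),
    mp_lact (y \ox (a * b)) =
    \tsum_(y1, y2 <- comul y) \tsum_(a1, a2 <- comul a)
      (mp_lact (y1 \ox a1) * mp_lact (mp_ract (y2 \ox a2) \ox b));
  mp_ractM : forall (y z : H) (a : A),
    mp_ract ((y * z) \ox a) =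
    \tsum_(z1, z2 <- comul z) \tsum_(a1, a2 <- comul a)
      (mp_ract (y \ox mp_lact (z1 \ox a1)) * mp_ract (z2 \ox a2));
  mp_swap : forall (y : H) (a : A),
    \tsum_(y1, y2 <- comul y) \tsum_(a1, a2 <- comul a)
      (mp_ract (y1 \ox a1) \ox mp_lact (y2 \ox a2)) =
    \tsum_(y1, y2 <- comul y) \tsum_(a1, a2 <- comul a)
      (mp_ract (y2 \ox a2) \ox mp_lact (y1 \ox a1))
}.

End MatchedPair.

Notation "y '<|[' mp ] a" := (mp_ract mp (y \ox a))
  (at level 40, format "y  '<|[' mp ]  a") : ring_scope.
Notation "y '|>[' mp ] a" := (mp_lact mp (y \ox a))
  (at level 40, format "y  '|>[' mp ]  a") : ring_scope.

Record hopfData (K : fieldType) (V : vectType K) := HopfData {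
  hd_mul : V -> V -> V;
  hd_one : V;
  hd_comul : V -> (V \ox V)%type;
  hd_counit : V -> K;
  hd_antipode : V -> V
}.

Definition hopf_data (K : fieldType) (A : hopfAlgType K) : hopfData A :=
  HopfData *%R 1 comul counit antipode.

Definition hopf_isomorphic (K : fieldType) (V W : vectType K)
    (DV : hopfData V) (DW : hopfData W) : Prop :=
  exists f : {linear V -> W},
    bijective f /\
    [/\ f (hd_one DV) = hd_one DW,
        forall u v, f (hd_mul DV u v) = hd_mul DW (f u) (f v),
        forall u, \tsum_(u1, u2 <- hd_comul DV u) (f u1 \ox f u2) =
                  hd_comul DW (f u),
        forall u, hd_counit DV u = hd_counit DW (f u)
      & forall u, f (hd_antipode DV u) = hd_antipode DW (f u)].

(* The operations of the bicrossed product; an isomorphism with (hopf_data of)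
   a Hopf algebra entails that they satisfy the Hopf algebra axioms. *)
Definition bicrossed (K : fieldType) (A H : hopfAlgType K)
    (mp : matchedPair A H) : hopfData (A \ox H)%type :=
  HopfData
    (fun s t => \tsum_(a, y <- s) \tsum_(b, z <- t)
       \tsum_(y1, y2 <- comul y) \tsum_(b1, b2 <- comul b)
         ((a * (y1 |>[mp] b1)) \ox ((y2 <|[mp] b2) * z)))
    (1 \ox 1)
    (fun s => \tsum_(a, y <- s)
       \tsum_(a1, a2 <- comul a) \tsum_(y1, y2 <- comul y)
         ((a1 \ox y1) \ox (a2 \ox y2)))
    (tlift (W := K^o) (fun a y => counit a * counit y))
    (fun s => \tsum_(a, y <- s)
       \tsum_(a1, a2 <- comul a) \tsum_(y1, y2 <- comul y)
         ((antipode y2 |>[mp] antipode a2) \ox (antipode y1 <|[mp] antipode a1))).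

Definition groupAlg (K : fieldType) (gT : finGroupType) : Type :=
  {ffun gT -> K}.

Section GroupAlgebra.
Context {K : fieldType} {gT : finGroupType}.
Local Notation KG := (groupAlg K gT).

HB.instance Definition _ := Vector.copy KG {ffun gT -> K^o}.

Implicit Types (f : KG) (g : gT).

Definition gelt g : KG := [ffun z => (z == g)%:R].

Definition galg_mul (f1 f2 : KG) : KG :=
  [ffun z => \sum_g f1 g * f2 (g^-1 * z)%g].

Lemma galgE f : f = \sum_g f g *: gelt g.
Proof.
apply/ffunP=> z; rewrite sum_ffunE (bigD1 z) //= big1 => [|g zg].
  by rewrite addr0 !ffunE eqxx [RHS]mulr1.
by rewrite !ffunE eq_sym (negPf zg); apply: mulr0.
Qed.

Lemma galg_mulA : associative galg_mul.
Proof.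
move=> f1 f2 f3; apply/ffunP=> z; rewrite !ffunE.
under eq_bigr do rewrite ffunE mulr_sumr.
under [RHS]eq_bigr do rewrite ffunE mulr_suml.
rewrite [RHS]exchange_big /=; apply: eq_bigr => g _.
rewrite [RHS](reindex_inj (mulgI g)) /=; apply: eq_bigr => g' _.
by rewrite mulKg invMg !mulgA mulrA.
Qed.

Lemma galg_mul1l : left_id (gelt 1%g) galg_mul.
Proof.
move=> f; apply/ffunP=> z; rewrite !ffunE (bigD1 1%g) //= big1 => [|g /negPf zg].
  by rewrite ffunE eqxx mul1r invg1 mul1g addr0.
by rewrite ffunE zg mul0r.
Qed.

Lemma galg_mul1r : right_id (gelt 1%g) galg_mul.
Proof.
move=> f; apply/ffunP=> z; rewrite !ffunE (bigD1 z) //= big1 => [|g /negPf zg].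
  by rewrite ffunE mulVg eqxx mulr1 addr0.
by rewrite ffunE -eq_mulVg1 zg mulr0.
Qed.

Lemma galg_mulDl : left_distributive galg_mul +%R.
Proof.
move=> f1 f2 f3; apply/ffunP=> z; rewrite !ffunE -big_split /=.
by apply: eq_bigr => g _; rewrite ffunE mulrDl.
Qed.

Lemma galg_mulDr : right_distributive galg_mul +%R.
Proof.
move=> f1 f2 f3; apply/ffunP=> z; rewrite !ffunE -big_split /=.
by apply: eq_bigr => g _; rewrite ffunE mulrDr.
Qed.

Lemma gelt1_neq0 : gelt 1%g != 0.
Proof.
apply/eqP=> /ffunP/(_ 1%g); rewrite !ffunE eqxx => /eqP.
by rewrite (oner_eq0 K).
Qed.

HB.instance Definition _ := GRing.Zmodule_isNzRing.Build KG
  galg_mulA galg_mul1l galg_mul1r galg_mulDl galg_mulDr gelt1_neq0.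

Lemma galg_scalerAl a f1 f2 : a *: (f1 * f2) = (a *: f1) * f2.
Proof.
apply/ffunP=> z; rewrite !ffunE [LHS]mulr_sumr.
by apply: eq_bigr => g _; rewrite ffunE mulrA.
Qed.

Lemma galg_scalerAr a f1 f2 : a *: (f1 * f2) = f1 * (a *: f2).
Proof.
apply/ffunP=> z; rewrite !ffunE [LHS]mulr_sumr.
by apply: eq_bigr => g _; rewrite ffunE [LHS]mulrCA.
Qed.

HB.instance Definition _ := GRing.Lmodule_isLalgebra.Build K KG galg_scalerAl.
HB.instance Definition _ := GRing.Lalgebra_isAlgebra.Build K KG galg_scalerAr.
HB.instance Definition _ := Algebra_isFalgebra.Build K KG.

Definition galg_ext {W : vectType K} (F : gT -> W) f : W := \sum_g f g *: F g.

Lemma galg_ext_is_linear (W : vectType K) (F : gT -> W) : linear (galg_ext F).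
Proof.
move=> a f1 f2; rewrite /galg_ext scaler_sumr -big_split /=.
by apply: eq_bigr => g _; rewrite !ffunE scalerDl scalerA.
Qed.

HB.instance Definition _ (W : vectType K) (F : gT -> W) :=
  GRing.isLinear.Build K KG W *:%R (galg_ext F) (galg_ext_is_linear F).

Lemma galg_ext_gelt (W : vectType K) (F : gT -> W) g :
  galg_ext F (gelt g) = F g.
Proof.
rewrite /galg_ext (bigD1 g) //= big1 => [|g' /negPf gg']; rewrite ffunE.
  by rewrite eqxx scale1r addr0.
by rewrite gg' scale0r.
Qed.

Lemma galg_linP (W : lmodType K) (F G : KG -> W) : linear F -> linear G ->
  (forall g, F (gelt g) = G (gelt g)) -> F =1 G.
Proof.
move=> Fl Gl FG f; rewrite (galgE f).
elim/big_rec: _ => [|g f' _ IH]; last by rewrite Fl Gl IH FG.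
by rewrite -(subrr 0) -scaleN1r addrC Fl Gl !scaleN1r !addNr.
Qed.

Lemma geltM g g' : gelt g * gelt g' = gelt (g * g')%g.
Proof.
apply/ffunP=> z; rewrite !ffunE (bigD1 g) //= big1 => [|g1 /negPf gg1].
  by rewrite !ffunE eqxx mul1r addr0 (can2_eq (mulKVg g) (mulKg g)).
by rewrite !ffunE gg1 mul0r.
Qed.

Definition galg_comul : {linear KG -> (KG \ox KG)%type} :=
  galg_ext (fun g => gelt g \ox gelt g).

Definition galg_sum f : K := \sum_g f g.

Lemma galg_sum_is_scalar : scalar galg_sum.
Proof.
move=> a f1 f2; rewrite /galg_sum mulr_sumr -big_split /=.
by apply: eq_bigr => g _; rewrite !ffunE.
Qed.

HB.instance Definition _ :=
  GRing.isLinear.Build K KG K *%R galg_sum galg_sum_is_scalar.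

Definition galg_counit : {scalar KG} := galg_sum.
Definition galg_antipode : {linear KG -> KG} :=
  galg_ext (fun g => gelt g^-1%g).

Lemma galg_comul_gelt g : galg_comul (gelt g) = gelt g \ox gelt g.
Proof. exact: galg_ext_gelt. Qed.

Lemma galg_counit_gelt g : galg_counit (gelt g) = 1.
Proof.
rewrite /= /galg_sum (bigD1 g) //= big1 => [|g' /negPf gg']; rewrite ffunE.
  by rewrite eqxx addr0.
by rewrite gg'.
Qed.

Lemma galg_antipode_gelt g : galg_antipode (gelt g) = gelt g^-1%g.
Proof. exact: galg_ext_gelt. Qed.

Lemma tlift_comul_linear (W : vectType K) (f : KG -> KG -> W) :
  linear (fun y => tlift f (galg_comul y)).
Proof. by move=> a f1 f2; rewrite !linearP. Qed.

Lemma tlift_comul_gelt (W : vectType K) (f : KG -> KG -> W) g :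
    (forall v, linear (f^~ v)) -> (forall u, linear (f u)) ->
  tlift f (galg_comul (gelt g)) = f (gelt g) (gelt g).
Proof. by move=> fl fr; rewrite galg_comul_gelt tlift_tens. Qed.

Lemma galg_comulA (y : KG) :
  \tsum_(y1, y2 <- galg_comul y) \tsum_(y11, y12 <- galg_comul y1)
    (y11 \ox (y12 \ox y2)) =
  \tsum_(y1, y2 <- galg_comul y) (y1 \ox galg_comul y2).
Proof.
move: y; apply: galg_linP => [||g]; try exact: tlift_comul_linear.
rewrite tlift_comul_gelt.
- rewrite !galg_comul_gelt !tlift_tens ?galg_comul_gelt //.
  + by move=> v a u u'; rewrite tensDl tensZl.
  + by move=> u a v v'; rewrite linearP tensDr tensZr.
  + by move=> v a u u'; rewrite tensDl tensZl.
  + by move=> u a v v'; rewrite tensDl tensDr tensZl tensZr.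
- by move=> v a u u'; rewrite !linearP.
move=> u a v v'; rewrite -tlift_funP; apply: eq_tlift => z z'.
by rewrite !tensDr !tensZr.
Qed.

Lemma galg_counitl (y : KG) :
  \tsum_(y1, y2 <- galg_comul y) galg_counit y1 *: y2 = y.
Proof.
move: y; apply: galg_linP => [||g] //; first exact: tlift_comul_linear.
rewrite tlift_comul_gelt ?galg_counit_gelt ?scale1r // => u a v w.
  by rewrite linearP scalerDl scalerA.
by rewrite scalerDr !scalerA mulrC.
Qed.

Lemma galg_counitr (y : KG) :
  \tsum_(y1, y2 <- galg_comul y) galg_counit y2 *: y1 = y.
Proof.
move: y; apply: galg_linP => [||g] //; first exact: tlift_comul_linear.
rewrite tlift_comul_gelt ?galg_counit_gelt ?scale1r // => u a v w.
  by rewrite scalerDr !scalerA mulrC.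
by rewrite linearP scalerDl scalerA.
Qed.

HB.instance Definition _ := Vector_isCoalgebra.Build K KG
  galg_comulA galg_counitl galg_counitr.

Lemma galg_comul1 : galg_comul 1 = 1 \ox 1.
Proof. exact: galg_comul_gelt. Qed.

Lemma galg_comulM f1 f2 :
  galg_comul (f1 * f2) = tmul (galg_comul f1) (galg_comul f2).
Proof.
move: f1; apply: galg_linP => [a u v|a u v|g].
- by rewrite mulrDl -scalerAl linearP.
- by rewrite /tmul !linearP.
move: f2; apply: galg_linP => [a u v|a u v|g'].
- by rewrite mulrDr -scalerAr linearP.
- by rewrite /tmul -tlift_funP; apply: eq_tlift => z z'; rewrite !linearP.
rewrite geltM /tmul tlift_comul_gelt.
- rewrite tlift_comul_gelt ?galg_comul_gelt ?geltM //.
    by move=> v a u u'; rewrite mulrDr -scalerAr tensDl tensZl.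
  by move=> v a u u'; rewrite mulrDr -scalerAr tensDr tensZr.
- move=> v a u u'; rewrite -tlift_funP; apply: eq_tlift => z z'.
  by rewrite mulrDl -scalerAl tensDl tensZl.
move=> v a u u'; rewrite -tlift_funP; apply: eq_tlift => z z'.
by rewrite mulrDl -scalerAl tensDr tensZr.
Qed.

Lemma galg_counit1 : galg_counit 1 = 1.
Proof. exact: galg_counit_gelt. Qed.

Lemma galg_counitM f1 f2 :
  galg_counit (f1 * f2) = galg_counit f1 * galg_counit f2.
Proof.
move: f1; apply: (@galg_linP K^o) => [a u v|a u v|g].
- by rewrite mulrDl -scalerAl linearP.
- by rewrite linearP mulrDl; congr (_ + _); rewrite -mulrA.
move: f2; apply: (@galg_linP K^o) => [a u v|a u v|g'].
- by rewrite mulrDr -scalerAr linearP.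
- by rewrite linearP mulrDr; congr (_ + _); apply: mulrCA.
by rewrite geltM !galg_counit_gelt mulr1.
Qed.

Lemma galg_antipodel f :
  \tsum_(f1, f2 <- galg_comul f) (galg_antipode f1 * f2) = galg_counit f *: 1.
Proof.
move: f; apply: galg_linP => [|a u v|g]; first exact: tlift_comul_linear.
  by rewrite linearP scalerDl scalerA.
rewrite tlift_comul_gelt.
- by rewrite galg_antipode_gelt galg_counit_gelt geltM mulVg scale1r.
- by move=> v a u u'; rewrite linearP mulrDl -scalerAl.
by move=> v a u u'; rewrite mulrDr -scalerAr.
Qed.

Lemma galg_antipoder f :
  \tsum_(f1, f2 <- galg_comul f) (f1 * galg_antipode f2) = galg_counit f *: 1.
Proof.
move: f; apply: galg_linP => [|a u v|g]; first exact: tlift_comul_linear.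
  by rewrite linearP scalerDl scalerA.
rewrite tlift_comul_gelt.
- by rewrite galg_antipode_gelt galg_counit_gelt geltM mulgV scale1r.
- by move=> v a u u'; rewrite mulrDl -scalerAl.
by move=> v a u u'; rewrite linearP mulrDr -scalerAr.
Qed.

HB.instance Definition _ := FalgCoalg_isHopfAlgebra.Build K KG
  galg_comul1 galg_comulM galg_counit1 galg_counitM
  galg_antipodel galg_antipoder.

End GroupAlgebra.

(* K<X_0, ..., X_(N-1)>, as the algebra of the free monoid on 'I_N. *)
Notation freeAlg K N := {malg K[{fmonom 'I_N}]}.

Definition ncvar (K : fieldType) (N : nat) (i : 'I_N) : freeAlg K N :=
  << fmu i >>.

Definition nceval (K : fieldType) (N : nat) (A : algType K) (v : N.-tuple A)
    (p : freeAlg K N) : A :=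
  \sum_(w <- msupp p) p@_w *: \prod_(i <- fmonom_val w) tnth v i.

Definition in_ideal_gen (R : pzRingType) (rels : seq R) (z : R) : Prop :=
  exists2 s : seq (R * R * R),
    {in s, forall u, u.1.2 \in rels} &
    z = \sum_(u <- s) u.1.1 * u.1.2 * u.2.

(* A is the quotient of the free algebra by the two-sided ideal generated by
   rels, the tuple v being the images of the free generators. *)
Definition is_presented (K : fieldType) (N : nat) (A : algType K)
    (v : N.-tuple A) (rels : seq (freeAlg K N)) : Prop :=
  (forall a : A, exists p, nceval v p = a) /\
  (forall p, nceval v p = 0 <-> in_ideal_gen rels p).

Definition taft_relators (K : fieldType) (m : nat) (q : K) :
    seq (freeAlg K 2) :=
  let h := ncvar K (0 : 'I_2) in let x := ncvar K (1 : 'I_2) in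
  [:: h ^+ m - 1; x ^+ m; x * h - q *: (h * x)].

Definition is_taft (K : fieldType) (m : nat) (q : K)
    (T : hopfAlgType K) (h x : T) : Prop :=
  is_presented [tuple h; x] (taft_relators m q) /\
  [/\ comul h = h \ox h, comul x = x \ox h + 1 \ox x,
      counit h = 1 & counit x = 0].

Definition Tbs_relators (K : fieldType) (m : nat) (q : K) (k l n : nat)
    (beta sigma : K) : seq (freeAlg K 4) :=
  let c := ncvar K (0 : 'I_4) in let d := ncvar K (1 : 'I_4) in
  let h := ncvar K (2 : 'I_4) in let x := ncvar K (3 : 'I_4) in
  [:: c ^+ l - 1; d ^+ n - 1; h ^+ m - 1; x ^+ m;
      c * h - h * c; d * h - h * d; c * d - d ^+ k * c;
      c * x - beta *: (x * c); d * x - sigma *: (x * d);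
      x * h - q *: (h * x)].

Definition is_Tbs (K : fieldType) (m : nat) (q : K) (k l n : nat)
    (beta sigma : K) (B : hopfAlgType K) (c d h x : B) : Prop :=
  [/\ is_presented [tuple c; d; h; x] (Tbs_relators m q k l n beta sigma),
      [/\ comul c = c \ox c, comul d = d \ox d, comul h = h \ox h
        & comul x = x \ox h + 1 \ox x],
      [/\ counit c = 1, counit d = 1, counit h = 1 & counit x = 0]
    & [/\ antipode h = h ^+ (m - 1), antipode x = - (x * h ^+ (m - 1)),
          antipode c = c ^+ (l - 1) & antipode d = d ^+ (n - 1)]].

(* gT is D_ln^k with c and d as its defining generators: gT is isomorphic to
   the presented group (which is finite), and since generators of gT satisfying
   the relations are the images of the abstract ones under an epimorphism
   between finite groups of the same order, c and d correspond to them under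
   some such isomorphism. *)
Definition is_Dlnk (k l n : nat) (gT : finGroupType) (c d : gT) : Prop :=
  [/\ [set: gT] \isog Grp (c : d : c ^+ l, d ^+ n, c * d = d ^+ k * c),
      <<[set c; d]>> = [set: gT],
      c ^+ l = 1, d ^+ n = 1 & c * d = d ^+ k * c]%g.

Definition rootsOfUnity (K : fieldType) (r : nat) : Type :=
  {z : K | r.-unity_root z}.

(* Main.v *)
(* For g in D_ln^k the elements u = g |> h and y = g |> x of the Taft algebra
   satisfy Delta(u) = u (x) u and Delta(y) = y (x) u + 1 (x) y. Pairing the first
   tensor factor with two functionals, read off the representation
   h |-> diag(1, q), x |-> E_12, yields two operators on T that are explicit on
   the basis h^i x^j, and solving the resulting linear equations gives u = h and
   y = chi(g) x + w with chi(g) <> 0 and w in K[h]. The compatibility of the two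
   actions at (g, x), paired with the same functionals, forces g <| h = g and
   g <| x = 0, so <| is trivial and every g acts by an algebra automorphism;
   then xh = q hx gives w = 0. Hence a matched pair is a character chi of
   D_ln^k, that is, a pair (chi(c), chi(d)) in U_l x U_(n, k-1).

   Conversely a character acts on T by Hopf automorphisms, and the bicrossed
   product is the skew group algebra of T over D_ln^k. Its presentation is
   obtained by rewriting words to the normal form h^a x^b d^t c^i, which are
   independent because D_ln^k has order l n, as its right regular
   representation on normal forms shows. *)
Require Import Defs.
From HB Require Import structures.
From mathcomp Require Import all_boot all_order all_algebra all_fingroup all_field.
From mathcomp Require Import finmap.
From mathcomp.multinomials Require Import monalg.
From Stdlib Require Import ProofIrrelevance.

Set Implicit Arguments.
Unset Strict Implicit.
Unset Printing Implicit Defensive.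

Import GRing.Theory.
Local Open Scope ring_scope.

(** * Free and presented algebras *)

(** Independence of normal forms is nowhere assumed: the Taft algebra and the target Hopf algebra
    are known only through presentations, so each basis claim rests on a concrete model on which the
    relations can be checked.

    What makes the linear equations solvable is the identity N D = q D N between the two operators.
    N multiplies h^i x^j by q^i, and D sends h^i x^j to (1 + q + ... + q^(j-1)) h^(i+1) x^(j-1). A
    grouplike element is an eigenvector of both, so q <> 1 forces D to kill it. The kernel of D is
    K[h], because the q-integers of 0 < j < m do not vanish, and inside K[h] the eigenvalue of N
    identifies the power of h. No list of the grouplike or skew primitive elements of T is required.
    The inequality chi(g) <> 0 needs its own argument: g acts injectively, and chi(g) = 0 would
    place x in the span of 1 and h.

    The exponent (n, k-1) appears because a character takes values in a commutative group: there cd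
    = d^k c becomes chi(d)^(k-1) = 1, to be combined with chi(d)^n = 1. *)

Section FreeAlgebra.
Context {K : fieldType} {N : nat}.
Implicit Types (p r : freeAlg K N).

(** Constants commute with every word. This is the identity handed over as [scaleAr] to the normal
    form sections, which are stated for left algebras. *)
Lemma free_scalerAr a p r : a *: (p * r) = p * (a *: r).
Proof.
rewrite -[LHS]mul_malgC -[a *: r]mul_malgC mulrA [RHS]mulrA.
apply: (congr1 (fun z => z * r)).
rewrite !malgM_def fgmulUg fgmulgU; apply: eq_bigr => w _.
by rewrite mulrC mul1m mulm1.
Qed.

Section Eval.
Context {A : algType K} (v : N.-tuple A).

Definition word_eval (w : {fmonom 'I_N}) : A :=
  \prod_(i <- fmonom_val w) tnth v i.

Lemma word_eval_mmorphism : mmorphism word_eval.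
Proof.
split=> [w1 w2|]; last by rewrite /word_eval fm1 big_nil.
by rewrite /word_eval fmM big_cat.
Qed.

HB.instance Definition _ :=
  isMultiplicative.Build {fmonom 'I_N} A word_eval word_eval_mmorphism.

Lemma nceval_mmap p : nceval v p = mmap (in_alg A) word_eval p.
Proof. by apply: eq_bigr => w _; rewrite /= -scalerAl mul1r. Qed.

Lemma nceval_is_linear : linear (nceval v).
Proof.
move=> a p r; rewrite !nceval_mmap mmapD mmapZ.
by rewrite /= -scalerAl mul1r.
Qed.

HB.instance Definition _ :=
  GRing.isLinear.Build K (freeAlg K N) A *:%R (nceval v) nceval_is_linear.

Lemma nceval_is_monoid_morphism : monoid_morphism (nceval v).
Proof.
split; first by rewrite nceval_mmap mmap1.
move=> p r; rewrite !nceval_mmap.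
apply: (@commr_mmap_is_multiplicative _ _ _ (in_alg A) word_eval _).1 => f w w'.
by rewrite /GRing.comm /= -scalerAl -scalerAr mul1r mulr1.
Qed.

HB.instance Definition _ :=
  GRing.isMonoidMorphism.Build (freeAlg K N) A (nceval v)
    nceval_is_monoid_morphism.

Lemma nceval_var i : nceval v (ncvar K i) = tnth v i.
Proof.
rewrite nceval_mmap mmapU /= scale1r mul1r.
by rewrite /word_eval fmU big_seq1.
Qed.

(* Stated for already evaluated arguments: rewriting with [rmorphM] would
   compare products of the free algebra up to conversion, which is very slow. *)
Lemma ncevalBE p r a b :
  nceval v p = a -> nceval v r = b -> nceval v (p - r) = a - b.
Proof. by move=> <- <-; rewrite linearB. Qed.

Lemma ncevalME p r a b :
  nceval v p = a -> nceval v r = b -> nceval v (p * r) = a * b.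
Proof. by move=> <- <-; rewrite rmorphM. Qed.

Lemma ncevalZE k p a : nceval v p = a -> nceval v (k *: p) = k *: a.
Proof. by move=> <-; rewrite linearZ. Qed.

Lemma ncevalXE p a i : nceval v p = a -> nceval v (p ^+ i) = a ^+ i.
Proof. by move=> <-; rewrite rmorphXn. Qed.

End Eval.

Lemma free_ind (P : freeAlg K N -> Prop) :
    (forall a p r, P p -> P r -> P (a *: p + r)) -> P 1 ->
    (forall i p, P p -> P (ncvar K i * p)) ->
  forall p, P p.
Proof.
move=> PZD P1 PM p; rewrite (monalgE p).
(* [P 0] comes from the combination [-1 *: 1 + 1]. *)
have P0 : P 0 by have := PZD (-1) 1 1 P1 P1; rewrite scaleN1r addNr.
elim/big_rec: _ => // w r _ Pr.
have -> : << p@_w *g w >> = p@_w *: << w >> :> freeAlg K N.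
  by rewrite -mul_malgC malgM_def fgmulUU mulr1 mul1m.
apply: PZD => //; rewrite -[w]fmK.
elim: (fmonom_val w) => [|i s IH]; first by rewrite -fmoneE.
suff -> : << FMonom (i :: s) >> = ncvar K i * << FMonom s >> :> freeAlg K N.
  exact: PM.
by rewrite malgM_def fgmulUU mulr1 /mul /= fmmulE fmuE.
Qed.

End FreeAlgebra.

(** * Congruence modulo a two-sided ideal *)

Section Ideal.
Context {K : fieldType} {R : lalgType K} (rels : seq R).
Implicit Types (p r s : R).
Local Notation I := (in_ideal_gen rels).

Lemma ideal_mem p : p \in rels -> I p.
Proof.
move=> pr; exists [:: (1, p, 1)] => [u|]; last by rewrite big_seq1 /= mulr1 mul1r.
by rewrite inE => /eqP->.
Qed.

Lemma ideal0 : I 0.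
Proof. by exists [::] => //; rewrite big_nil. Qed.

Lemma idealD p r : I p -> I r -> I (p + r).
Proof.
move=> [s1 i1 ->] [s2 i2 ->]; exists (s1 ++ s2); last by rewrite big_cat.
by move=> u; rewrite mem_cat => /orP[/i1|/i2].
Qed.

Lemma idealMl s p : I p -> I (s * p).
Proof.
move=> [s1 i1 ->]; exists [seq (s * u.1.1, u.1.2, u.2) | u <- s1].
  by move=> _ /mapP[u /i1 ur ->].
by rewrite big_map mulr_sumr; apply: eq_bigr => u _; rewrite /= !mulrA.
Qed.

Lemma idealMr s p : I p -> I (p * s).
Proof.
move=> [s1 i1 ->]; exists [seq (u.1.1, u.1.2, u.2 * s) | u <- s1].
  by move=> _ /mapP[u /i1 ur ->].
by rewrite big_map mulr_suml; apply: eq_bigr => u _; rewrite /= !mulrA.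
Qed.

Lemma idealZ a p : I p -> I (a *: p).
Proof. by move=> Ip; rewrite -[p]mul1r scalerAl; apply: idealMl. Qed.

Lemma idealN p : I p -> I (- p).
Proof. by rewrite -scaleN1r; apply: idealZ. Qed.

Definition eqmod p r : Prop := I (p - r).

Lemma eqmod_refl p : eqmod p p.
Proof. by rewrite /eqmod subrr; apply: ideal0. Qed.

Lemma eqmod_sym p r : eqmod p r -> eqmod r p.
Proof. by move/idealN; rewrite opprB. Qed.

Lemma eqmod_trans p r s : eqmod p r -> eqmod r s -> eqmod p s.
Proof. by move=> /idealD pr /pr; rewrite addrA subrK. Qed.

Lemma eqmodD p r p' r' : eqmod p r -> eqmod p' r' -> eqmod (p + p') (r + r').
Proof. by move=> /idealD pr /pr; rewrite addrACA -opprD. Qed.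

Lemma eqmodZ a p r : eqmod p r -> eqmod (a *: p) (a *: r).
Proof. by move/(idealZ a); rewrite scalerBr. Qed.

Lemma eqmodMl s p r : eqmod p r -> eqmod (s * p) (s * r).
Proof. by move/(idealMl s); rewrite mulrBr. Qed.

Lemma eqmodMr s p r : eqmod p r -> eqmod (p * s) (r * s).
Proof. by move/(idealMr s); rewrite mulrBl. Qed.

Lemma eqmod_exp_modn p e i : (0 < e)%N -> eqmod (p ^+ e) 1 ->
  eqmod (p ^+ i) (p ^+ (i %% e)).
Proof.
move=> e0 pe; rewrite {1}(divn_eq i e) exprD mulnC exprM.
rewrite -[X in eqmod _ X]mul1r; apply: eqmodMr.
elim: (i %/ e)%N => [|b IH]; first exact: eqmod_refl.
rewrite exprS; apply: eqmod_trans (eqmodMr _ pe) _; rewrite mul1r.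
exact: IH.
Qed.

Lemma eqmod_commX a p r i :
    (forall b s t, b *: (s * t) = s * (b *: t) :> R) ->
  eqmod (p * r) (a *: (r * p)) ->
  eqmod (p * r ^+ i) (a ^+ i *: (r ^+ i * p)).
Proof.
move=> scaleAr pr; elim: i => [|i IH].
  by rewrite !expr0 scale1r mul1r mulr1; apply: eqmod_refl.
have := eqmod_trans (eqmodMr (r ^+ i) pr) _.
move/(_ (a ^+ i.+1 *: (r ^+ i.+1 * p))); rewrite -mulrA -exprS; apply.
rewrite -scalerAl (exprS a) (exprS r) -scalerA; apply: eqmodZ.
by rewrite -!mulrA scaleAr; apply: eqmodMl.
Qed.

End Ideal.

Lemma ideal_eval0 (K : fieldType) (N : nat) (rels : seq (freeAlg K N))
    (A : algType K) (v : N.-tuple A) :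
    {in rels, forall p, nceval v p = 0} ->
  forall p, in_ideal_gen rels p -> nceval v p = 0.
Proof.
move=> v0 _ [s sr ->]; rewrite linear_sum /= big_seq big1 // => u /sr /v0 u0.
by rewrite !rmorphM /= u0 mulr0 mul0r.
Qed.

(** * Induction and universal property for a presented algebra *)

Section Presented.
Context {K : fieldType} {N : nat} {A : algType K} {v : N.-tuple A}.
Context {rels : seq (freeAlg K N)} (vP : is_presented v rels).

Lemma presented_rel p : p \in rels -> nceval v p = 0.
Proof. by move=> pr; apply/vP.2/ideal_mem. Qed.

Lemma presented_ind (P : A -> Prop) :
    (forall a u w, P u -> P w -> P (a *: u + w)) -> P 1 ->
    (forall i u, P u -> P (tnth v i * u)) ->
  forall u, P u.
Proof.
move=> PZD P1 PM u; have [p <-] := vP.1 u.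
move: p; apply: free_ind => [a p r Pp Pr||i p Pp].
- by rewrite linearP; apply: PZD.
- by rewrite rmorph1.
- by rewrite rmorphM /= nceval_var; apply: PM.
Qed.

(** The value at [u] is computed on a chosen preimage in the free algebra. Two preimages differ by
    an element of the ideal, which evaluation at [w] kills, so the choice does not matter and
    linearity and multiplicativity follow. *)
Lemma presented_lift (B : algType K) (w : N.-tuple B) :
    {in rels, forall p, nceval w p = 0} ->
  exists2 f : {linear A -> B}, monoid_morphism f &
    forall i, f (tnth v i) = tnth w i.
Proof.
move=> w0.
have ex u : exists p, nceval v p == u by have [p <-] := vP.1 u; exists p.
pose f u := nceval w (xchoose (ex u)).
have fE p : f (nceval v p) = nceval w p.
  apply/eqP; rewrite -subr_eq0 -linearB /=; apply/eqP/(ideal_eval0 w0)/vP.2.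
  by rewrite linearB /= (eqP (xchooseP (ex _))) subrr.
have fl : linear f.
  move=> a u1 u2; have [p1 <-] := vP.1 u1; have [p2 <-] := vP.1 u2.
  by rewrite -linearP !fE linearP.
have fm : monoid_morphism f.
  split=> [|u1 u2]; first by rewrite -(rmorph1 (nceval v)) fE rmorph1.
  have [p1 <-] := vP.1 u1; have [p2 <-] := vP.1 u2.
  by rewrite -rmorphM !fE rmorphM.
exists (HB.pack_for {linear A -> B} f (GRing.isLinear.Build K A B *:%R f fl)) => //.
by move=> i /=; rewrite -nceval_var fE nceval_var.
Qed.

End Presented.

(** * Multilinear maps and tensors *)

Section Multilinear.
Context {K : fieldType}.

Lemma lin_id (U : lmodType K) : linear (fun u : U => u).
Proof. by []. Qed.

Lemma lin_comp (U V W : lmodType K) (L : {linear V -> W}) (f : U -> V) :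
  linear f -> linear (fun u => L (f u)).
Proof. by move=> fl a u v; rewrite fl linearP. Qed.

Lemma lin_tensl (U : lmodType K) (V W : vectType K) (f : U -> V) (w : W) :
  linear f -> linear (fun u => f u \ox w).
Proof. by move=> fl a u v; rewrite fl tensDl tensZl. Qed.

Lemma lin_tensr (U : lmodType K) (V W : vectType K) (f : U -> V) (w : W) :
  linear f -> linear (fun u => w \ox f u).
Proof. by move=> fl a u v; rewrite fl tensDr tensZr. Qed.

Lemma lin_mull (U : lmodType K) (A : algType K) (f : U -> A) (w : A) :
  linear f -> linear (fun u => f u * w).
Proof. by move=> fl a u v; rewrite fl mulrDl scalerAl. Qed.

Lemma lin_mulr (U : lmodType K) (A : algType K) (f : U -> A) (w : A) :
  linear f -> linear (fun u => w * f u).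
Proof. by move=> fl a u v; rewrite fl mulrDr scalerAr. Qed.

Lemma lin_scalel (U V : lmodType K) (f : U -> K) (w : V) :
  scalar f -> linear (fun u => f u *: w).
Proof. by move=> fl a u v; rewrite fl scalerDl scalerA. Qed.

Lemma lin_scaler (U V : lmodType K) (f : U -> V) b :
  linear f -> linear (fun u => b *: f u).
Proof. by move=> fl a u v; rewrite fl scalerDr !scalerA mulrC. Qed.

Lemma lin_tlift (U : lmodType K) (V W Y : vectType K) (F : U -> V -> W -> Y) t :
    (forall v w, linear (fun u => F u v w)) ->
  linear (fun u => \tsum_(v, w <- t) F u v w).
Proof.
by move=> Fl a u u'; rewrite -tlift_funP; apply: eq_tlift => v w; apply: Fl.
Qed.

Lemma lin_galg_ext (gT : finGroupType) (U : lmodType K) (W : vectType K) 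
    (F : U -> gT -> W) (y : groupAlg K gT) :
  (forall g, linear (F^~ g)) -> linear (fun u => galg_ext (F u) y).
Proof.
move=> Fl a u v; rewrite /galg_ext scaler_sumr -big_split /=.
by apply: eq_bigr => g _; rewrite Fl scalerDr !scalerA mulrC.
Qed.

Lemma lin_scalar (U V : lmodType K) (L : {scalar V}) (f : U -> V) :
  linear f -> scalar (fun u => L (f u)).
Proof. by move=> fl a u v; rewrite fl linearP. Qed.

Lemma scalar_mull (U : lmodType K) (f : U -> K) b :
  scalar f -> scalar (fun u => f u * b).
Proof. by move=> fl a u v; rewrite fl mulrDl mulrA. Qed.

Lemma scalar_mulr (U : lmodType K) (f : U -> K) b :
  scalar f -> scalar (fun u => b * f u).
Proof. by move=> fl a u v; rewrite fl mulrDr mulrCA. Qed.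

End Multilinear.

(** Evaluating a Sweedler sum with [tlift_tens], or testing an identity on a basis, leaves linearity
    goals. They are closed by peeling off one operation at a time until the identity map remains. *)
Ltac lin_step :=
  cbv beta;
  first [ apply: lin_id
        | apply: lin_tensl | apply: lin_tensr
        | apply: lin_mull | apply: lin_mulr
        | apply: lin_scalel | apply: lin_scaler
        | apply: lin_tlift | apply: lin_galg_ext | apply: lin_comp
        | apply: lin_scalar | apply: scalar_mull | apply: scalar_mulr ].

Ltac lin := repeat (intros; lin_step).

Section TensorMore.
Context {K : fieldType}.
Implicit Types (U V W : vectType K).

Lemma linear_tlift U V W W' (L : {linear W -> W'}) (f : U -> V -> W) t :
  L (tlift f t) = \tsum_(a, b <- t) L (f a b).
Proof.
rewrite linear_sum; apply: eq_bigr => i _; rewrite linear_sum.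
by apply: eq_bigr => j _; rewrite linearZ.
Qed.

(** Pure tensors of basis vectors span, since [coord] is dual to [vbasis]. This is what allows
    linear maps on a tensor product to be compared on pure tensors. *)
Lemma tlift_id U V (t : (U \ox V)%type) : \tsum_(a, b <- t) (a \ox b) = t.
Proof.
apply/matrixP => i j; rewrite summxE (bigD1 i) //= summxE (bigD1 j) //=.
rewrite !mxE !coord_free ?(basis_free (vbasisP _)) //.
rewrite !eqxx !mulr1 big1 => [|j' /negPf jj'].
  rewrite addr0 big1 ?addr0 // => i' /negPf ii'; rewrite summxE big1 // => j' _.
  by rewrite !mxE !coord_free ?(basis_free (vbasisP _)) // ii' mul0r mulr0.
rewrite !mxE !coord_free ?(basis_free (vbasisP _)) //.
by rewrite jj' !mulr0.
Qed.

Lemma tlift_tmul (A B : falgType K) W (f : A -> B -> W) s t :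
    (forall v, linear (f^~ v)) -> (forall u, linear (f u)) ->
  tlift f (tmul s t) =
  \tsum_(a, b <- s) \tsum_(a', b' <- t) f (a * a') (b * b').
Proof.
move=> fl fr; rewrite linear_tlift; apply: eq_tlift => a b.
by rewrite linear_tlift; apply: eq_tlift => a' b'; rewrite /= tlift_tens.
Qed.

Lemma tlift_prod U V U' V' (A : falgType K) (F : U -> V -> A)
    (G : U' -> V' -> A) s t :
  \tsum_(a, b <- s) \tsum_(a', b' <- t) (F a b * G a' b') =
  tlift F s * tlift G t.
Proof.
rewrite [RHS]mulr_suml; apply: eq_bigr => i _; rewrite mulr_suml.
apply: eq_bigr => j _; rewrite -scalerAl; congr (_ *: _).
rewrite mulr_sumr; apply: eq_bigr => i' _; rewrite mulr_sumr.
by apply: eq_bigr => j' _; rewrite -scalerAr.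
Qed.

End TensorMore.

(** * Skew group Hopf algebras *)

Record hopfAction (K : fieldType) (gT : finGroupType) (T : hopfAlgType K) :=
  HopfAction {
  hact :> gT -> {linear T -> T};
  hact1 : forall a, hact 1%g a = a;
  hactM : forall g g' a, hact (g * g')%g a = hact g (hact g' a);
  hact_one : forall g, hact g 1 = 1;
  hact_mul : forall g a b, hact g (a * b) = hact g a * hact g b;
  hact_comul : forall g a, comul (hact g a) =
    \tsum_(a1, a2 <- comul a) (hact g a1 \ox hact g a2);
  hact_counit : forall g a, counit (hact g a) = counit a
}.

(** A function [f] stands for the sum of the [f g] times [g], coefficients on the left. The action
    is a parameter of the type so that each action carries its own multiplication. *)
Definition skewGroupAlg (K : fieldType) (gT : finGroupType)
  (T : hopfAlgType K) (phi : hopfAction gT T) : Type := {ffun gT -> T}.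

Section SkewGroupAlgebra.
Context {K : fieldType} {gT : finGroupType} {T : hopfAlgType K}.
Context {phi : hopfAction gT T}.
Local Notation B := (skewGroupAlg phi).
Implicit Types (f : B) (g : gT) (a : T).

HB.instance Definition _ := Vector.copy B {ffun gT -> T}.

Definition single g a : B := [ffun z => if z == g then a else 0].

Lemma single_is_linear g : linear (single g).
Proof.
move=> b a a'; apply/ffunP=> z; rewrite !ffunE.
by case: eqP; rewrite ?scaler0 ?addr0.
Qed.

HB.instance Definition _ g :=
  GRing.isLinear.Build K T B *:%R (single g) (single_is_linear g).

Lemma skewE f : f = \sum_g single g (f g).
Proof.
apply/ffunP=> z; rewrite sum_ffunE (bigD1 z) //= big1 => [|g /negPf zg].
  by rewrite addr0 ffunE eqxx.
by rewrite ffunE eq_sym zg.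
Qed.

Definition skew_ext {W : lmodType K} (F : gT -> {linear T -> W}) f : W :=
  \sum_g F g (f g).

Lemma skew_ext_is_linear (W : lmodType K) (F : gT -> {linear T -> W}) :
  linear (skew_ext F).
Proof.
move=> b f1 f2; rewrite /skew_ext scaler_sumr -big_split /=.
by apply: eq_bigr => g _; rewrite !ffunE linearP.
Qed.

HB.instance Definition _ (W : lmodType K) (F : gT -> {linear T -> W}) :=
  GRing.isLinear.Build K B W *:%R (skew_ext F) (skew_ext_is_linear F).

Lemma skew_ext_single (W : lmodType K) (F : gT -> {linear T -> W}) g a :
  skew_ext F (single g a) = F g a.
Proof.
rewrite /skew_ext (bigD1 g) //= big1 => [|g' /negPf gg']; rewrite ffunE.
  by rewrite eqxx addr0.
by rewrite gg' linear0.
Qed.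

Lemma skew_linP (W : lmodType K) (F G : B -> W) : linear F -> linear G ->
  (forall g a, F (single g a) = G (single g a)) -> F =1 G.
Proof.
move=> Fl Gl FG f; rewrite (skewE f).
elim/big_rec: _ => [|g f' _ IH]; last first.
  by rewrite -[single g _]scale1r Fl Gl IH FG.
by rewrite -(subrr 0) -scaleN1r addrC Fl Gl !scaleN1r !addNr.
Qed.

Lemma skew_scalarP (F G : B -> K) : scalar F -> scalar G ->
  (forall g a, F (single g a) = G (single g a)) -> F =1 G.
Proof. exact: (@skew_linP K^o). Qed.

(** Convolution twisted by the rule that moving [g] to the right past [b] turns [b] into
    [phi g b]. *)
Definition skew_mul f1 f2 : B :=
  [ffun z => \sum_g f1 g * phi g (f2 (g^-1 * z)%g)].

Lemma skew_mulA : associative skew_mul.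
Proof.
move=> f1 f2 f3; apply/ffunP=> z; rewrite !ffunE.
under eq_bigr do rewrite ffunE linear_sum mulr_sumr.
under [RHS]eq_bigr do rewrite ffunE mulr_suml.
rewrite [RHS]exchange_big /=; apply: eq_bigr => g _.
rewrite [RHS](reindex_inj (mulgI g)) /=; apply: eq_bigr => g' _.
by rewrite mulKg invMg !mulgA hact_mul hactM mulrA.
Qed.

Lemma skew_mul1l : left_id (single 1%g 1) skew_mul.
Proof.
move=> f; apply/ffunP=> z; rewrite !ffunE (bigD1 1%g) //= big1 => [|g /negPf zg].
  by rewrite ffunE eqxx mul1r invg1 mul1g hact1 addr0.
by rewrite ffunE zg mul0r.
Qed.

Lemma skew_mul1r : right_id (single 1%g 1) skew_mul.
Proof.
move=> f; apply/ffunP=> z; rewrite !ffunE (bigD1 z) //= big1 => [|g /negPf zg].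
  by rewrite ffunE mulVg eqxx hact_one mulr1 addr0.
by rewrite ffunE -eq_mulVg1 zg linear0 mulr0.
Qed.

Lemma skew_mulDl : left_distributive skew_mul +%R.
Proof.
move=> f1 f2 f3; apply/ffunP=> z; rewrite !ffunE -big_split /=.
by apply: eq_bigr => g _; rewrite ffunE mulrDl.
Qed.

Lemma skew_mulDr : right_distributive skew_mul +%R.
Proof.
move=> f1 f2 f3; apply/ffunP=> z; rewrite !ffunE -big_split /=.
by apply: eq_bigr => g _; rewrite ffunE linearD mulrDr.
Qed.

Lemma skew_one_neq0 : single 1%g 1 != 0.
Proof.
by apply/eqP=> /ffunP/(_ 1%g); rewrite !ffunE eqxx => /eqP; rewrite oner_eq0.
Qed.

HB.instance Definition _ := GRing.Zmodule_isNzRing.Build B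
  skew_mulA skew_mul1l skew_mul1r skew_mulDl skew_mulDr skew_one_neq0.

Lemma skew_scalerAl b f1 f2 : b *: (f1 * f2) = (b *: f1) * f2.
Proof.
apply/ffunP=> z; rewrite !ffunE scaler_sumr.
by apply: eq_bigr => g _; rewrite ffunE scalerAl.
Qed.

Lemma skew_scalerAr b f1 f2 : b *: (f1 * f2) = f1 * (b *: f2).
Proof.
apply/ffunP=> z; rewrite !ffunE scaler_sumr.
by apply: eq_bigr => g _; rewrite ffunE linearZ /= scalerAr.
Qed.

HB.instance Definition _ := GRing.Lmodule_isLalgebra.Build K B skew_scalerAl.
HB.instance Definition _ := GRing.Lalgebra_isAlgebra.Build K B skew_scalerAr.
HB.instance Definition _ := Algebra_isFalgebra.Build K B.

Lemma singleM g g' a a' :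
  single g a * single g' a' = single (g * g')%g (a * phi g a').
Proof.
apply/ffunP=> z; rewrite !ffunE (bigD1 g) //= big1 => [|g1 /negPf gg1].
  rewrite !ffunE eqxx addr0 (can2_eq (mulKVg g) (mulKg g)).
  by case: eqP; rewrite ?linear0 ?mulr0.
by rewrite !ffunE gg1 mul0r.
Qed.

Lemma skew1E : 1 = single 1%g 1 :> B.
Proof. by []. Qed.

Definition skew_comul : {linear B -> (B \ox B)%type} :=
  skew_ext (fun g =>
    [the {linear T -> _} of
      tlift (fun a1 a2 => single g a1 \ox single g a2) \o comul]).

Definition skew_sum f : K := \sum_g counit (f g).

Lemma skew_sum_is_scalar : scalar skew_sum.
Proof.
move=> b f1 f2; rewrite /skew_sum mulr_sumr -big_split /=.
by apply: eq_bigr => g _; rewrite !ffunE linearP.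
Qed.

HB.instance Definition _ :=
  GRing.isLinear.Build K B K *%R skew_sum skew_sum_is_scalar.

Definition skew_counit : {scalar B} := skew_sum.

(** Antimultiplicativity sends a g to g^-1 S(a); bringing S(a) back to the left of g^-1 applies
    [phi g^-1]. *)
Definition skew_antipode : {linear B -> B} :=
  skew_ext (fun g =>
    [the {linear T -> B} of single g^-1%g \o phi g^-1%g \o antipode]).

Lemma skew_comul_single g a : skew_comul (single g a) =
  \tsum_(a1, a2 <- comul a) (single g a1 \ox single g a2).
Proof. exact: skew_ext_single. Qed.

Lemma skew_counit_single g a : skew_counit (single g a) = counit a.
Proof.
rewrite /= /skew_sum (bigD1 g) //= big1 => [|g' /negPf gg']; rewrite ffunE.
  by rewrite eqxx addr0.
by rewrite gg' linear0.
Qed.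

Lemma skew_antipode_single g a :
  skew_antipode (single g a) = single g^-1%g (phi g^-1%g (antipode a)).
Proof. exact: skew_ext_single. Qed.

Lemma tlift_skew_comul (W : vectType K) (F : B -> B -> W) g a :
    (forall v, linear (F^~ v)) -> (forall u, linear (F u)) ->
  tlift F (skew_comul (single g a)) =
  \tsum_(a1, a2 <- comul a) F (single g a1) (single g a2).
Proof.
move=> Fl Fr; rewrite skew_comul_single linear_tlift.
by apply: eq_tlift => a1 a2; rewrite /= tlift_tens.
Qed.

Lemma skew_comulA f :
  \tsum_(y1, y2 <- skew_comul f) \tsum_(y11, y12 <- skew_comul y1)
    (y11 \ox (y12 \ox y2)) =
  \tsum_(y1, y2 <- skew_comul f) (y1 \ox skew_comul y2).
Proof.
move: f; apply: skew_linP => [||g a]; [by lin | by lin |].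
rewrite !tlift_skew_comul; try by lin.
(* [L] carries both sides of the coassociativity of [T] into the component of [g]. *)
pose L : T -> (T \ox T)%type -> (B \ox (B \ox B))%type := fun a1 t =>
  single g a1 \ox (\tsum_(a2, a3 <- t) (single g a2 \ox single g a3)).
transitivity (tlift L (\tsum_(a1, a2 <- comul a) (a1 \ox comul a2))).
  rewrite -comulA linear_tlift; apply: eq_tlift => a1 a2 /=.
  rewrite linear_tlift tlift_skew_comul; try by lin.
  apply: eq_tlift => a3 a4 /=.
  by rewrite tlift_tens /L ?tlift_tens //; lin.
rewrite linear_tlift; apply: eq_tlift => a1 a2 /=.
by rewrite tlift_tens /L ?skew_comul_single //; lin.
Qed.

Lemma skew_counitl f :
  \tsum_(y1, y2 <- skew_comul f) skew_counit y1 *: y2 = f.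
Proof.
move: f; apply: skew_linP => [||g a]; [by lin | by [] |].
rewrite tlift_skew_comul; try by lin.
rewrite -[in RHS](counitl a) linear_tlift; apply: eq_tlift => a1 a2.
by rewrite skew_counit_single linearZ.
Qed.

Lemma skew_counitr f :
  \tsum_(y1, y2 <- skew_comul f) skew_counit y2 *: y1 = f.
Proof.
move: f; apply: skew_linP => [||g a]; [by lin | by [] |].
rewrite tlift_skew_comul; try by lin.
rewrite -[in RHS](counitr a) linear_tlift; apply: eq_tlift => a1 a2.
by rewrite skew_counit_single linearZ.
Qed.

HB.instance Definition _ := Vector_isCoalgebra.Build K B
  skew_comulA skew_counitl skew_counitr.

Lemma skew_comul1 : skew_comul 1 = 1 \ox 1.
Proof. by rewrite skew1E skew_comul_single comul1 tlift_tens //; lin. Qed.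

Lemma skew_comulM f1 f2 :
  skew_comul (f1 * f2) = tmul (skew_comul f1) (skew_comul f2).
Proof.
move: f1; apply: skew_linP => [||g a]; [by lin | by lin |].
move: f2; apply: skew_linP => [||g' a']; [by lin | by lin |].
rewrite singleM skew_comul_single comulM tlift_tmul; try by lin.
rewrite /tmul tlift_skew_comul; try by lin.
apply: eq_tlift => a1 a2.
rewrite hact_comul linear_tlift tlift_skew_comul; try by lin.
apply: eq_tlift => a1' a2' /=.
by rewrite tlift_tens ?singleM //; lin.
Qed.

Lemma skew_counit1 : skew_counit 1 = 1.
Proof. by rewrite skew1E skew_counit_single counit1. Qed.

Lemma skew_counitM f1 f2 :
  skew_counit (f1 * f2) = skew_counit f1 * skew_counit f2.
Proof.
move: f1; apply: skew_scalarP => [||g a]; [by lin | by lin |].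
move: f2; apply: skew_scalarP => [||g' a']; [by lin | by lin |].
by rewrite singleM !skew_counit_single counitM hact_counit.
Qed.

Lemma skew_antipodel f :
  \tsum_(f1, f2 <- skew_comul f) (skew_antipode f1 * f2) = skew_counit f *: 1.
Proof.
move: f; apply: skew_linP => [||g a]; [by lin | by lin |].
rewrite tlift_skew_comul; try by lin.
(* The unit is written as [phi g^-1 1], so that the antipode axiom of [T] applies under
   [phi g^-1]. *)
rewrite skew_counit_single skew1E -linearZ -[1](hact_one phi g^-1%g).
rewrite -linearZ -antipodel !linear_tlift; apply: eq_tlift => a1 a2 /=.
by rewrite skew_antipode_single singleM mulVg hact_mul.
Qed.

Lemma skew_antipoder f :
  \tsum_(f1, f2 <- skew_comul f) (f1 * skew_antipode f2) = skew_counit f *: 1.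
Proof.
move: f; apply: skew_linP => [||g a]; [by lin | by lin |].
rewrite tlift_skew_comul; try by lin.
rewrite skew_counit_single skew1E -linearZ.
rewrite -antipoder !linear_tlift; apply: eq_tlift => a1 a2 /=.
by rewrite skew_antipode_single singleM mulgV -hactM mulgV hact1.
Qed.

HB.instance Definition _ := FalgCoalg_isHopfAlgebra.Build K B
  skew_comul1 skew_comulM skew_counit1 skew_counitM
  skew_antipodel skew_antipoder.

End SkewGroupAlgebra.

(** * Matched pairs from group actions *)

Section GroupAlgebraActions.
Context {K : fieldType} {gT : finGroupType}.
Local Notation KG := (groupAlg K gT).

Lemma comul_gelt (g : gT) : comul (gelt g : KG) = gelt g \ox gelt g.
Proof. exact: galg_comul_gelt. Qed.

Lemma counit_gelt (g : gT) : counit (gelt g : KG) = 1.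
Proof. exact: galg_counit_gelt. Qed.

Lemma antipode_gelt (g : gT) : antipode (gelt g : KG) = gelt g^-1%g.
Proof. exact: galg_antipode_gelt. Qed.

Lemma tlift_comul_geltE (W : vectType K) (f : KG -> KG -> W) g :
    (forall v, linear (f^~ v)) -> (forall u, linear (f u)) ->
  tlift f (comul (gelt g : KG)) = f (gelt g) (gelt g).
Proof. exact: tlift_comul_gelt. Qed.

Lemma galg_scalarP (F G : KG -> K) : scalar F -> scalar G ->
  (forall g, F (gelt g) = G (gelt g)) -> F =1 G.
Proof. exact: (@galg_linP K gT K^o). Qed.

Lemma tens_galg_linP (U : vectType K) (W : lmodType K)
    (F G : (U \ox KG)%type -> W) : linear F -> linear G ->
  (forall u g, F (u \ox gelt g) = G (u \ox gelt g)) -> F =1 G.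
Proof.
move=> Fl Gl FG t.
have E : forall u y, F (u \ox y) = G (u \ox y).
  move=> u; apply: galg_linP => [a y y'|a y y'|g]; last exact: FG.
    by rewrite tensDr tensZr Fl.
  by rewrite tensDr tensZr Gl.
pose F' := HB.pack_for {linear (U \ox KG)%type -> W} F
  (GRing.isLinear.Build K _ _ _ F Fl).
pose G' := HB.pack_for {linear (U \ox KG)%type -> W} G
  (GRing.isLinear.Build K _ _ _ G Gl).
rewrite -[F]/(F' : _ -> _) -[G]/(G' : _ -> _) -[t]tlift_id !linear_sum.
apply: eq_bigr => i _; rewrite !linear_sum; apply: eq_bigr => j _.
by rewrite !linearZ /= E.
Qed.

End GroupAlgebraActions.

Section CounitSum.
Context {K : fieldType} {C : coalgType K} {W : vectType K}.

(** The way a trivial right action is exploited: it leaves a factor [counit] on one leg, and the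
    Sweedler sum collapses. *)
Lemma tlift_counitl (L : C -> W) (y : C) : linear L ->
  \tsum_(y1, y2 <- comul y) counit y1 *: L y2 = L y.
Proof.
move=> Ll; pose L' := HB.pack_for {linear C -> W} L
  (GRing.isLinear.Build K C W *:%R L Ll).
rewrite -[in RHS](counitl y) -[L]/(L' : _ -> _) linear_tlift.
by apply: eq_tlift => y1 y2; rewrite linearZ.
Qed.

Lemma tlift_counitr (L : C -> W) (y : C) : linear L ->
  \tsum_(y1, y2 <- comul y) counit y2 *: L y1 = L y.
Proof.
move=> Ll; pose L' := HB.pack_for {linear C -> W} L
  (GRing.isLinear.Build K C W *:%R L Ll).
rewrite -[in RHS](counitr y) -[L]/(L' : _ -> _) linear_tlift.
by apply: eq_tlift => y1 y2; rewrite linearZ.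
Qed.

End CounitSum.

Lemma scalar_tlift (K : fieldType) (U V W : vectType K) (L : {scalar W})
    (f : U -> V -> W) t :
  L (tlift f t) = tlift (W := K^o) (fun a b => L (f a b)) t.
Proof.
rewrite linear_sum; apply: eq_bigr => i _; rewrite linear_sum.
by apply: eq_bigr => j _; rewrite linearZ.
Qed.

(** Apply [counit] to the left antipode axiom: by multiplicativity the second leg contributes only
    its counit, and the sum collapses to [counit (antipode a)]. *)
Lemma counit_antipode (K : fieldType) (H : hopfAlgType K) (a : H) :
  counit (antipode a) = counit a.
Proof.
have <- : counit (\tsum_(a1, a2 <- comul a) (antipode a1 * a2) : H) = counit a.
  by rewrite antipodel linearZ /= counit1; apply: mulr1.
rewrite scalar_tlift.
rewrite -(@tlift_counitr _ _ K^o (fun a => counit (antipode a))); last by lin.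
by apply: (@eq_tlift _ _ _ K^o) => a1 a2; rewrite counitM [RHS]mulrC.
Qed.

Lemma antipode1 (K : fieldType) (H : hopfAlgType K) : antipode (1 : H) = 1.
Proof.
have := antipodel (1 : H); rewrite comul1 tlift_tens; try by lin.
by rewrite mulr1 counit1 scale1r.
Qed.

Lemma counitX (K : fieldType) (H : hopfAlgType K) (u : H) i :
  counit (u ^+ i) = counit u ^+ i.
Proof. by elim: i => [|i IH]; rewrite ?counit1 // !exprS counitM IH. Qed.

Section ActionMatchedPair.
Context {K : fieldType} {gT : finGroupType} {T : hopfAlgType K}.
Variable (phi : hopfAction gT T).
Local Notation KG := (groupAlg K gT).

Definition act_lact : 'Hom((KG \ox T)%type, T) :=
  linfun (tlift (fun (y : KG) a => galg_ext (fun g => phi g a) y)).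

Definition act_ract : 'Hom((KG \ox T)%type, KG) :=
  linfun (tlift (fun (y : KG) (a : T) => counit a *: y)).

Lemma act_lact_gelt g a : act_lact (gelt g \ox a) = phi g a.
Proof. by rewrite lfunE /= tlift_tens ?galg_ext_gelt //; lin. Qed.

Lemma act_ractE y a : act_ract (y \ox a) = counit a *: y.
Proof. by rewrite lfunE /= tlift_tens //; lin. Qed.

Lemma act_left_module_coalgebra : is_left_module_coalgebra act_lact.
Proof.
split=> [a|y z a|y a|y a].
- by rewrite act_lact_gelt hact1.
- move: y; apply: galg_linP => [||g]; [by lin | by lin |].
  move: z; apply: galg_linP => [||g']; [by lin | by lin |].
  by rewrite geltM !act_lact_gelt hactM.
- move: y; apply: galg_linP => [||g]; [by lin | by lin |].
  rewrite act_lact_gelt hact_comul tlift_comul_geltE; try by lin.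
  by apply: eq_tlift => a1 a2; rewrite !act_lact_gelt.
- move: y; apply: galg_scalarP => [||g]; [by lin | by lin |].
  by rewrite act_lact_gelt hact_counit counit_gelt mul1r.
Qed.

Lemma act_right_module_coalgebra : is_right_module_coalgebra act_ract.
Proof.
split=> [y|y a b|y a|y a].
- by rewrite act_ractE counit1 scale1r.
- by rewrite !act_ractE counitM scalerA mulrC.
- move: y; apply: galg_linP => [||g]; [by lin | by lin |].
  rewrite act_ractE linearZ /= comul_gelt tlift_tens; try by lin.
  pose L (b : T) := counit b *: (gelt g \ox gelt g : (KG \ox KG)%type).
  rewrite -[LHS]/(L a) -tlift_counitl; last by rewrite /L; lin.
  by apply: eq_tlift => a1 a2; rewrite !act_ractE tensZl tensZr.
- by rewrite act_ractE linearZ mulrC.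
Qed.

Lemma act_lact1 (y : KG) : act_lact (y \ox 1) = counit y *: 1.
Proof.
move: y; apply: galg_linP => [||g]; [by lin | by lin |].
by rewrite act_lact_gelt hact_one counit_gelt scale1r.
Qed.

Lemma act_ract1 a : act_ract (1 \ox a) = counit a *: 1.
Proof. exact: act_ractE. Qed.

Lemma act_lactM (y : KG) (a b : T) :
  act_lact (y \ox (a * b)) =
  \tsum_(y1, y2 <- comul y) \tsum_(a1, a2 <- comul a)
    (act_lact (y1 \ox a1) * act_lact (act_ract (y2 \ox a2) \ox b)).
Proof.
move: y; apply: galg_linP => [||g]; [by lin | by lin |].
rewrite tlift_comul_geltE; try by lin.
rewrite act_lact_gelt hact_mul.
rewrite -(@tlift_counitr _ _ _ (fun a => phi g a * phi g b)); last by lin.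
apply: eq_tlift => a1 a2.
by rewrite act_ractE tensZl linearZ /= !act_lact_gelt scalerAr.
Qed.

Lemma act_ractM (y z : KG) (a : T) :
  act_ract ((y * z) \ox a) =
  \tsum_(z1, z2 <- comul z) \tsum_(a1, a2 <- comul a)
    (act_ract (y \ox act_lact (z1 \ox a1)) * act_ract (z2 \ox a2)).
Proof.
move: z; apply: galg_linP => [||g]; [by lin | by lin |].
rewrite tlift_comul_geltE; try by lin.
rewrite act_ractE.
rewrite -(@tlift_counitl _ _ _ (fun a => counit a *: (y * gelt g))); last by lin.
apply: eq_tlift => a1 a2.
by rewrite !act_ractE act_lact_gelt hact_counit -scalerAl -scalerAr.
Qed.

(** For a grouplike [gelt g] both sides equal [gelt g \ox phi g a]: the counit absorbs the first leg
    of [a] on the left-hand side and the second leg on the right-hand side. *)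
Lemma act_swap (y : KG) (a : T) :
  \tsum_(y1, y2 <- comul y) \tsum_(a1, a2 <- comul a)
    (act_ract (y1 \ox a1) \ox act_lact (y2 \ox a2)) =
  \tsum_(y1, y2 <- comul y) \tsum_(a1, a2 <- comul a)
    (act_ract (y2 \ox a2) \ox act_lact (y1 \ox a1)).
Proof.
move: y; apply: galg_linP => [||g]; [by lin | by lin |].
rewrite !tlift_comul_geltE; try by lin.
transitivity (gelt g \ox phi g a : (KG \ox T)%type).
  rewrite -(@tlift_counitl _ _ _ (fun a => gelt g \ox phi g a)); last by lin.
  by apply: eq_tlift => a1 a2; rewrite act_ractE act_lact_gelt tensZl.
rewrite -(@tlift_counitr _ _ _ (fun a => gelt g \ox phi g a)); last by lin.
by apply: eq_tlift => a1 a2; rewrite act_ractE act_lact_gelt tensZl.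
Qed.

Definition act_matchedPair : matchedPair T KG :=
  MatchedPair act_left_module_coalgebra act_right_module_coalgebra
    act_lact1 act_ract1 act_lactM act_ractM act_swap.

End ActionMatchedPair.

(** * The bicrossed product when the right action is trivial *)

Section BicrossedSkew.
Context {K : fieldType} {gT : finGroupType} {T : hopfAlgType K}.
Variables (phi : hopfAction gT T) (mp : matchedPair T (groupAlg K gT)).
Hypothesis mp_lactE : forall g a, gelt g |>[mp] a = phi g a.
Hypothesis mp_ractE : forall g a, gelt g <|[mp] a = counit a *: gelt g.
Local Notation KG := (groupAlg K gT).
Local Notation B := (skewGroupAlg phi).

Definition tens_gelt g (a : T) : (T \ox KG)%type := a \ox gelt g.

Lemma tens_gelt_is_linear g : linear (tens_gelt g).
Proof. by rewrite /tens_gelt; lin. Qed.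

HB.instance Definition _ g :=
  GRing.isLinear.Build K T (T \ox KG)%type *:%R (tens_gelt g)
    (tens_gelt_is_linear g).

(** The isomorphism is [a \ox gelt g] to [single g a]. Trivial right action reduces the product of a
    g and b g' to a (g |> b) g g', the rule [singleM]; the comultiplication is already that of the
    tensor coalgebra. All identities are tested on the tensors [a \ox gelt g]. *)
Lemma bicrossed_skew_isomorphic :
  hopf_isomorphic (bicrossed mp) (hopf_data B).
Proof.
pose f : {linear (T \ox KG)%type -> B} :=
  tlift (fun a (y : KG) => galg_ext (fun g => single g a : B) y).
have fE a g : f (a \ox gelt g) = single g a.
  by rewrite /f /= tlift_tens ?galg_ext_gelt //; lin.
pose f' : {linear B -> (T \ox KG)%type} := skew_ext (fun g => tens_gelt g).
have f'E g a : f' (single g a) = a \ox gelt g by apply: skew_ext_single.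
exists f; split; [exists f'|split].
- by apply: tens_galg_linP => [||a g]; [lin | lin |]; rewrite fE f'E.
- by apply: skew_linP => [||a g]; [lin | lin |]; rewrite f'E fE.
- exact: fE.
- move=> s t; move: s; apply: tens_galg_linP => [||a g]; [by lin | by lin |].
  move: t; apply: tens_galg_linP => [||b g']; [by lin | by lin |].
  rewrite !fE /= !tlift_tens; try by lin.
  rewrite comul_gelt tlift_tens; try by lin.
  rewrite [in RHS]/GRing.mul /= -[RHS]/(single g a * single g' b) singleM.
  rewrite -fE -(@tlift_counitr _ _ _
    (fun b => (a * phi g b) \ox gelt (g * g')%g)); last by lin.
  congr (f _); apply: eq_tlift => b1 b2.
  by rewrite mp_lactE mp_ractE -scalerAl geltM tensZr.
- apply: tens_galg_linP => [||a g]; [by lin | by lin |].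
  rewrite fE /= tlift_tens; try by lin.
  rewrite -[RHS]/(comul (single g a : B)) [RHS]skew_comul_single.
  rewrite linear_tlift; apply: eq_tlift => a1 a2.
  rewrite comul_gelt tlift_tens; try by lin.
  by rewrite /= tlift_tens ?fE //; lin.
- apply: (@tens_galg_linP _ _ _ K^o) => [||a g]; [by lin | by lin |].
  rewrite fE /= tlift_tens; try by lin.
  rewrite counit_gelt -[RHS]/(skew_counit (single g a : B)) skew_counit_single.
  exact: mulr1.
- apply: tens_galg_linP => [||a g]; [by lin | by lin |].
  rewrite fE /= tlift_tens; try by lin.
  rewrite -[RHS]/(skew_antipode (single g a : B)) skew_antipode_single.
  rewrite -fE -(@tlift_counitl _ _ _
    (fun a => phi g^-1%g (antipode a) \ox gelt g^-1%g)); last by lin.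
  congr (f _); apply: eq_tlift => a1 a2.
  rewrite comul_gelt tlift_tens; try by lin.
  by rewrite antipode_gelt mp_lactE mp_ractE counit_antipode tensZr.
Qed.

End BicrossedSkew.

(** * The group [D_ln^k] *)

Section Dlnk.
Context (k l n : nat) (gT : finGroupType) (c d : gT).
Hypotheses (l_gt0 : (0 < l)%N) (n_gt0 : (0 < n)%N).
Hypothesis (kl_mod_n : (k ^ l = 1 %[mod n])%N).

(** The second coordinate of the model below lives modulo [l], while the twist uses [k] to that
    power modulo [n]; this makes the two reductions compatible. *)
Lemma expn_modl i : (k ^ (i %% l) = k ^ i %[mod n])%N.
Proof.
rewrite [in RHS](divn_eq i l) expnD (mulnC (i %/ l)%N) expnM.
by rewrite -[in RHS]modnMml -[in RHS]modnXm kl_mod_n modnXm exp1n modnMml mul1n.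
Qed.

(* A permutation model of [D_ln^k]: the right regular representation on the
   normal forms [d ^+ a * c ^+ b]. *)
Definition model_c (u : 'I_n * 'I_l) : 'I_n * 'I_l :=
  (u.1, Ordinal (ltn_pmod (u.2 + 1) l_gt0)).
Definition model_d (u : 'I_n * 'I_l) : 'I_n * 'I_l :=
  (Ordinal (ltn_pmod (u.1 + k ^ u.2) n_gt0), u.2).

Lemma model_c_inj : injective model_c.
Proof.
move=> [a b] [a' b'] [-> /eqP]; rewrite eqn_modDr !modn_small // => /eqP bb'.
by congr (_, _); apply: val_inj.
Qed.

Lemma model_d_inj : injective model_d.
Proof.
move=> [a b] [a' b'] [/eqP + bb']; rewrite bb' eqn_modDr !modn_small //.
by move=> /eqP aa'; congr (_, _); apply: val_inj.
Qed.

Let C := perm model_c_inj.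
Let D := perm model_d_inj.

Lemma model_cX i u : (C ^+ i)%g u = (u.1, Ordinal (ltn_pmod (u.2 + i) l_gt0)).
Proof.
elim: i => [|i IH].
  rewrite expg0 perm1 [LHS]surjective_pairing; congr (_, _); apply: val_inj.
  by rewrite /= addn0 modn_small.
rewrite expgSr permM IH permE /model_c; congr (_, _); apply: val_inj.
by rewrite /= modnDml addn1 addnS.
Qed.

Lemma model_dX i u :
  (D ^+ i)%g u = (Ordinal (ltn_pmod (u.1 + i * k ^ u.2) n_gt0), u.2).
Proof.
elim: i => [|i IH].
  rewrite expg0 perm1 [LHS]surjective_pairing; congr (_, _); apply: val_inj.
  by rewrite /= addn0 modn_small.
rewrite expgSr permM IH permE /model_d; congr (_, _); apply: val_inj.
by rewrite /= modnDml mulSnr addnA.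
Qed.

Lemma model_cl : (C ^+ l = 1)%g.
Proof.
apply/permP => u; rewrite model_cX perm1 [RHS]surjective_pairing.
by congr (_, _); apply: val_inj; rewrite /= modnDr modn_small.
Qed.

Lemma model_dn : (D ^+ n = 1)%g.
Proof.
apply/permP => u; rewrite model_dX perm1 [RHS]surjective_pairing.
by congr (_, _); apply: val_inj; rewrite /= addnC mulnC modnMDl modn_small.
Qed.

(** Permutations compose from left to right, as right multiplications do: both sides send (a, b) to
    (a + k^(b+1), b + 1), coordinates being reduced modulo n and l. *)
Lemma model_cd : (C * D = D ^+ k * C)%g.
Proof.
apply/permP => u; rewrite !permM model_dX !permE /model_c /model_d /=.
congr (_, _); apply: val_inj => /=.
by rewrite -modnDmr expn_modl modnDmr addn1 expnS.
Qed.

Hypothesis gT_D : is_Dlnk k l n c d.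

(** The group generated by the model is a homomorphic image of [gT] by the presentation. It contains
    the n l permutations [D ^+ a * C ^+ b], which are distinct because they send (0, 0) to (a,
    b). *)
Lemma Dlnk_card_ge : (n * l <= #|gT|)%N.
Proof.
have [isoD _ _ _ _] := gT_D.
pose H := (<[C]> <*> <[D]>)%G.
have: (H \homg [set: gT])%g.
  rewrite isoD; apply/existsP; exists (C, D).
  by rewrite /= model_cl model_dn model_cd !xpair_eqE !eqxx.
move/leq_homg; rewrite cardsT; apply: leq_trans.
have -> : (n * l = #|{: 'I_n * 'I_l}|)%N by rewrite card_prod !card_ord.
pose f (u : 'I_n * 'I_l) := (D ^+ u.1 * C ^+ u.2)%g.
have f_inj : injective f.
  move=> u u' /(congr1 (fun s : {perm _} => s (Ordinal n_gt0, Ordinal l_gt0))).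
  rewrite /f !permM !model_dX !model_cX /= => -[].
  rewrite expn0 !muln1 !add0n !modn_small // => e1 e2.
  by apply/eqP; rewrite -pair_eqE /= -!val_eqE /= e1 e2 !eqxx.
rewrite -(card_imset _ f_inj); apply/subset_leq_card/subsetP => _ /imsetP[u _ ->].
by rewrite groupM // groupX // mem_gen // inE cycle_id ?orbT.
Qed.

Lemma Dlnk_cX i t : (c ^+ i * d ^+ t = d ^+ (k ^ i * t) * c ^+ i)%g.
Proof.
have [_ _ _ _ cd] := gT_D.
have cdt s : (c * d ^+ s = d ^+ (k * s) * c)%g.
  elim: s => [|s IH]; first by rewrite muln0 !expg0 mulg1 mul1g.
  by rewrite expgSr mulgA IH -mulgA cd mulgA -expgD mulnS addnC.
elim: i t => [|i IH] t; first by rewrite !expg0 mulg1 mul1g mul1n.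
by rewrite expgSr -mulgA cdt mulgA IH -mulgA expnSr mulnA.
Qed.

Lemma Dlnk_mul t i t' i' :
  (d ^+ t * c ^+ i * (d ^+ t' * c ^+ i') =
   d ^+ (t + k ^ i * t') * c ^+ (i + i'))%g.
Proof. by rewrite !expgD !mulgA -[in LHS](mulgA _ (c ^+ i)%g) Dlnk_cX !mulgA. Qed.

Lemma Dlnk_mod t i : (d ^+ t * c ^+ i = d ^+ (t %% n) * c ^+ (i %% l))%g.
Proof. by have [_ _ cl dn _] := gT_D; rewrite !expg_mod. Qed.

Definition Dlnk_nf (u : 'I_n * 'I_l) : gT := (d ^+ u.1 * c ^+ u.2)%g.

(** Normal forms contain the generators and are closed under products by [Dlnk_mul]; in a finite
    group that already makes them a subgroup. *)
Lemma Dlnk_nf_surj g : exists u, g = Dlnk_nf u.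
Proof.
have [_ gen cl dn _] := gT_D.
have nfE t i : (d ^+ t * c ^+ i)%g \in Dlnk_nf @: setT.
  rewrite Dlnk_mod; apply/imsetP.
  by exists (Ordinal (ltn_pmod t n_gt0), Ordinal (ltn_pmod i l_gt0)).
have nf_group : group_set (Dlnk_nf @: setT).
  apply/group_setP; split; first by have := nfE 0 0; rewrite !expg0 mulg1.
  by move=> _ _ /imsetP[u _ ->] /imsetP[u' _ ->]; rewrite Dlnk_mul; apply: nfE.
suff /subsetP/(_ g) : [set: gT] \subset Group nf_group.
  by rewrite inE => /(_ isT)/imsetP[u _ ->]; exists u.
rewrite -gen gen_subG subUset !sub1set /=.
by have := nfE 0 1; have := nfE 1 0; rewrite !expg0 !expg1 mulg1 mul1g => -> ->.
Qed.

Lemma Dlnk_nf_surjb g : exists u, g == Dlnk_nf u.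
Proof. by have [u ->] := Dlnk_nf_surj g; exists u. Qed.

(** A map from n l elements onto a group with at least n l elements is injective. *)
Lemma Dlnk_nf_inj : injective Dlnk_nf.
Proof.
suff /imset_injP inj : #|Dlnk_nf @: setT| == #|[set: 'I_n * 'I_l]|.
  by move=> u u' uu'; apply: inj; rewrite ?inE.
rewrite eqn_leq leq_imset_card cardsT card_prod !card_ord.
apply: leq_trans Dlnk_card_ge _; rewrite -cardsT; apply/subset_leq_card.
apply/subsetP => g _; have [u ->] := Dlnk_nf_surj g.
exact: imset_f.
Qed.

Definition Dlnk_code g : 'I_n * 'I_l := xchoose (Dlnk_nf_surjb g).

Lemma Dlnk_codeK : cancel Dlnk_code Dlnk_nf.
Proof. by move=> g; apply/esym/eqP/(xchooseP (Dlnk_nf_surjb g)). Qed.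

Lemma Dlnk_code_nf t i : Dlnk_code (d ^+ t * c ^+ i)%g =
  (Ordinal (ltn_pmod t n_gt0), Ordinal (ltn_pmod i l_gt0)).
Proof. by apply: Dlnk_nf_inj; rewrite Dlnk_codeK Dlnk_mod. Qed.

(** * The character attached to a pair of roots of unity *)

Section Character.
Context {K : fieldType} (beta sigma : K).
Hypotheses (beta_l : beta ^+ l = 1) (sigma_gcd : sigma ^+ gcdn n (k - 1) = 1).

Lemma sigma_n : sigma ^+ n = 1.
Proof.
by rewrite -(divnK (dvdn_gcdl n (k - 1))) mulnC exprM sigma_gcd expr1n.
Qed.

Hypothesis k_gt0 : (0 < k)%N.

Lemma sigma_k : sigma ^+ k = sigma.
Proof.
rewrite -[in LHS](subnK k_gt0) exprD expr1.
by rewrite -(divnK (dvdn_gcdr n (k - 1))) mulnC exprM sigma_gcd expr1n mul1r.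
Qed.

Definition Dlnk_char g : K :=
  beta ^+ (Dlnk_code g).2 * sigma ^+ (Dlnk_code g).1.

Lemma Dlnk_charE t i :
  Dlnk_char (d ^+ t * c ^+ i)%g = beta ^+ i * sigma ^+ t.
Proof. by rewrite /Dlnk_char Dlnk_code_nf /= !expr_mod // sigma_n. Qed.

(** Moving [c ^+ i] past [d ^+ t'] multiplies t' by k^i, which [sigma] does not see since
    [sigma ^+ k = sigma]. *)
Lemma Dlnk_charM g g' : Dlnk_char (g * g')%g = Dlnk_char g * Dlnk_char g'.
Proof.
have [[t i] ->] := Dlnk_nf_surj g; have [[t' i'] ->] := Dlnk_nf_surj g'.
rewrite /Dlnk_nf /= Dlnk_mul !Dlnk_charE !exprD mulrACA; congr (_ * (_ * _)).
rewrite exprM; congr (_ ^+ _); elim: (nat_of_ord i) => // j IH.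
by rewrite expnS exprM sigma_k.
Qed.

Lemma Dlnk_char1 : Dlnk_char 1%g = 1.
Proof. by have := Dlnk_charE 0 0; rewrite !expg0 mulg1 !expr0 mulr1. Qed.

End Character.

End Dlnk.

(** * The Taft algebra *)

Section Coordinates.
Context {K : fieldType} {V : lmodType K} {J : finType} (e : J -> V).
Hypothesis e_span : forall u, exists a : {ffun J -> K}, u == \sum_j a j *: e j.
Hypothesis e_free :
  forall a : {ffun J -> K}, \sum_j a j *: e j = 0 -> a =1 (fun=> 0).

(** Spanning is stated with boolean equality so that [xchoose] can pick the coefficients; freeness
    then makes them unique, hence linear in [u]. *)
Definition fam_coord u : {ffun J -> K} := xchoose (e_span u).

Lemma fam_coordE u : u = \sum_j fam_coord u j *: e j.
Proof. exact/eqP/(xchooseP (e_span u)). Qed.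

Lemma fam_coord_uniq (a : J -> K) u j :
  u = \sum_j a j *: e j -> fam_coord u j = a j.
Proof.
move=> ua; apply/eqP; rewrite -subr_eq0; apply/eqP.
have /e_free/(_ j) : \sum_j [ffun j => fam_coord u j - a j] j *: e j = 0.
  under eq_bigr do rewrite ffunE scalerBl.
  by rewrite sumrB -fam_coordE -ua subrr.
by rewrite ffunE.
Qed.

Lemma fam_coord_is_scalar j : scalar (fam_coord^~ j).
Proof.
move=> a u v; apply: (@fam_coord_uniq (fun j => a * fam_coord u j + fam_coord v j)).
under eq_bigr do rewrite scalerDl -scalerA.
by rewrite big_split -scaler_sumr -!fam_coordE.
Qed.

Lemma fam_coord_e j j' : fam_coord (e j) j' = (j == j')%:R.
Proof.
apply: (@fam_coord_uniq (fun j' => (j == j')%:R)).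
rewrite (bigD1 j) //= eqxx scale1r big1 ?addr0 // => i /negPf ij.
by rewrite eq_sym ij scale0r.
Qed.

End Coordinates.

(** A cyclic module: [X] shifts the basis and [H] is diagonal with eigenvalues [lam * q ^- j].
    Column 0 of [H ^+ i * X ^+ s] is the basis vector s scaled by the i-th power of its eigenvalue,
    so this column separates the values of s, and varying [lam] separates the values of i. *)
Lemma taft_model (K : fieldType) (m : nat) (q lam : K) :
    q ^+ m.+1 = 1 -> lam ^+ m.+1 = 1 ->
  exists H X : 'M[K]_m.+1,
    [/\ H ^+ m.+1 = 1, X ^+ m.+1 = 0, X * H = q *: (H * X) &
        forall i s (j : 'I_m.+1),
          (H ^+ i * X ^+ s) j 0 = (j == s :> nat)%:R * (lam * q ^- s) ^+ i].
Proof.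
move=> qm lm.
have q0 : q != 0.
  by apply/eqP=> q0; move/eqP: qm; rewrite q0 expr0n eq_sym oner_eq0.
pose H : 'M[K]_m.+1 := diag_mx (\row_j (lam * q ^- j)).
pose X : 'M[K]_m.+1 := \matrix_(i, j) (i == j.+1 :> nat)%:R.
have HX i : H ^+ i = diag_mx (\row_j (lam * q ^- j) ^+ i).
  elim: i => [|i IH]; apply/matrixP => a b.
    by rewrite expr0 !mxE.
  rewrite exprS IH [_ * _]mulmx_diag !mxE exprS.
  by case: eqP => // ->; rewrite !mxE.
have XX s : X ^+ s = \matrix_(i, j) (i == j + s :> nat)%N%:R.
  elim: s => [|s IH]; apply/matrixP => a b.
    by rewrite expr0 !mxE addn0.
  rewrite exprSr IH !mxE.
  case: (ltnP b.+1 m.+1) => bm.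
    rewrite (bigD1 (Ordinal bm)) //= !mxE eqxx mulr1 big1 ?addr0 ?addnS //.
    move=> i /negPf ib; rewrite !mxE; case: (i =P b.+1 :> nat); rewrite ?mulr0 //.
    by move=> ib'; move: ib; rewrite -val_eqE /= ib' eqxx.
  rewrite big1 => [|i _]; last first.
    by rewrite !mxE (ltn_eqF (leq_trans (ltn_ord i) bm)) mulr0.
  rewrite ltn_eqF // addnS; apply: leq_trans (ltn_ord a) (leq_trans bm _).
  by rewrite ltnS leq_addr.
exists H, X; split.
- rewrite HX; apply/matrixP => a b; rewrite !mxE.
  by rewrite exprMn lm mul1r exprVn -exprM mulnC exprM qm expr1n invr1.
- rewrite XX; apply/matrixP => a b; rewrite !mxE ltn_eqF //.
  by apply: leq_trans (ltn_ord a) _; rewrite leq_addl.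
- rewrite [X * H]mul_mx_diag [H * X]mul_diag_mx; apply/matrixP => a b.
  rewrite !mxE; case: (a =P b.+1 :> nat) => [->|_]; last first.
    by rewrite mul0r !mulr0.
  by rewrite mul1r mulr1 exprS invfM [RHS]mulrCA mulVKf.
- move=> i s j; rewrite HX XX [_ * _]mul_diag_mx !mxE add0n.
  by case: eqP => [->|_]; rewrite ?mulr1 ?mul1r ?mulr0 ?mul0r.
Qed.

Section Taft.
Context {K : fieldType} {m : nat} {q : K} {T : hopfAlgType K} {h x : T}.
Hypotheses (m_ge2 : (2 <= m)%N) (q_prim : m.-primitive_root q).
Hypothesis T_taft : is_taft m q h x.

Let m_gt0 : (0 < m)%N. Proof. exact: ltnW. Qed.

Let q_neq1 : q != 1.
Proof.
by rewrite -[q]expr1 -(prim_order_dvd q_prim) dvdn1 gtn_eqF.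
Qed.

Let q_neq0 : q != 0.
Proof.
apply/eqP=> q0; have /eqP := prim_expr_order q_prim.
by rewrite q0 expr0n gtn_eqF // eq_sym oner_eq0.
Qed.

Lemma taft_hm : h ^+ m = 1.
Proof.
have /presented_rel := T_taft.1.
move/(_ (ncvar K 0 ^+ m - 1)); rewrite linearB /= rmorphXn rmorph1 /= nceval_var.
by move/(_ (mem_head _ _))/eqP; rewrite subr_eq0 => /eqP.
Qed.

Lemma taft_xm : x ^+ m = 0.
Proof.
have /presented_rel := T_taft.1.
move/(_ (ncvar K 1 ^+ m)); rewrite rmorphXn /= nceval_var; apply.
by rewrite !inE eqxx ?orbT.
Qed.

Lemma taft_xh : x * h = q *: (h * x).
Proof.
have : nceval [tuple h; x]
    (ncvar K 1 * ncvar K 0 - q *: (ncvar K 0 * ncvar K 1)) = 0.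
  by apply: (presented_rel T_taft.1); rewrite !inE eqxx ?orbT.
have -> := ncevalBE (ncevalME (nceval_var _ 1) (nceval_var _ 0))
  (ncevalZE q (ncevalME (nceval_var [tuple h; x] 0) (nceval_var _ 1))).
by move/eqP; rewrite subr_eq0 => /eqP.
Qed.

Lemma taft_ind (P : T -> Prop) :
    (forall a u w, P u -> P w -> P (a *: u + w)) -> P 1 ->
    (forall u, P u -> P (h * u)) -> (forall u, P u -> P (x * u)) ->
  forall u, P u.
Proof.
move=> PZD P1 Ph Px; apply: (presented_ind T_taft.1) => // -[[|[|//]] i] u Pu.
  by rewrite (tnth_nth 0) /=; apply: Ph.
by rewrite (tnth_nth 0) /=; apply: Px.
Qed.

Lemma taft_lift (A : algType K) (h' x' : A) :
    h' ^+ m = 1 -> x' ^+ m = 0 -> x' * h' = q *: (h' * x') ->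
  exists f : {linear T -> A}, [/\ monoid_morphism f, f h = h' & f x = x'].
Proof.
move=> hm xm xh; pose w := [tuple h'; x'].
have [|f fM fE] := presented_lift T_taft.1 (w := w).
  move=> p; rewrite !inE => /or3P[] /eqP->.
  - by rewrite linearB /= rmorphXn rmorph1 /= nceval_var hm subrr.
  - by rewrite rmorphXn /= nceval_var.
  - rewrite (ncevalBE (ncevalME (nceval_var w 1) (nceval_var w 0))
      (ncevalZE q (ncevalME (nceval_var w 0) (nceval_var w 1)))).
    by apply/eqP; rewrite subr_eq0; apply/eqP.
by exists f; split=> //; [exact: (fE 0) | exact: (fE 1)].
Qed.

Lemma taft_xXh s i : x ^+ s * h ^+ i = q ^+ (s * i) *: (h ^+ i * x ^+ s).
Proof.
have xhX j : x * h ^+ j = q ^+ j *: (h ^+ j * x).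
  elim: j => [|j IH]; first by rewrite !expr0 mulr1 mul1r scale1r.
  rewrite {1}(exprS h) mulrA taft_xh -scalerAl -(mulrA h) IH -scalerAr scalerA.
  by rewrite mulrA -!exprS.
elim: s => [|s IH]; first by rewrite !expr0 mulr1 mul1r scale1r.
rewrite {1}(exprS x) -mulrA IH -scalerAr (mulrA x) xhX -scalerAl scalerA -exprD.
by rewrite -mulrA -exprS addnC -mulSn.
Qed.

Definition taft_mon (p : 'I_m * 'I_m) : T := h ^+ p.1 * x ^+ p.2.

Lemma taft_hX i : h ^+ i = h ^+ (i %% m).
Proof. by rewrite expr_mod // taft_hm. Qed.

Lemma taft_xX s : (m <= s)%N -> x ^+ s = 0.
Proof. by move=> ms; rewrite -(subnK ms) exprD taft_xm mulr0. Qed.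

Lemma taft_span u :
  exists a : {ffun 'I_m * 'I_m -> K}, u == \sum_p a p *: taft_mon p.
Proof.
pose P u := exists a : {ffun 'I_m * 'I_m -> K}, u == \sum_p a p *: taft_mon p.
have PZD a v w : P v -> P w -> P (a *: v + w).
  move=> [b /eqP->] [b' /eqP->]; exists [ffun p => a * b p + b' p].
  under [X in _ == X]eq_bigr do rewrite ffunE scalerDl -scalerA.
  by rewrite big_split -scaler_sumr.
have P0 : P 0.
  by exists [ffun=> 0]; rewrite big1 // => p _; rewrite ffunE scale0r.
have Pmon i s : P (h ^+ i * x ^+ s).
  case: (ltnP s m) => sm; last by rewrite (taft_xX sm) mulr0.
  rewrite taft_hX; set p := (Ordinal (ltn_pmod i m_gt0), Ordinal sm).
  exists [ffun p' => (p' == p)%:R]; rewrite (bigD1 p) //= ffunE eqxx scale1r.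
  by rewrite big1 ?addr0 // => p' /negPf pp'; rewrite ffunE pp' scale0r.
have Psum (F : T -> T) : linear F -> (forall p, P (F (taft_mon p))) ->
    forall v, P v -> P (F v).
  move=> Fl PF v [a /eqP->].
  elim/big_rec: _ => [|p w _ IH]; last by rewrite Fl; apply: PZD.
  by rewrite -(subrr 0) -scaleN1r addrC Fl scaleN1r addNr.
move: u; apply: taft_ind => // [|u|u].
- by have := Pmon 0 0; rewrite !expr0 mulr1.
- by apply: Psum; [lin | move=> p; rewrite mulrA -exprS].
- apply: Psum; [by lin | move=> p; rewrite mulrA -[x]expr1 taft_xXh].
  by rewrite -scalerAl -mulrA -exprD -[_ *: _]addr0; apply: PZD.
Qed.

(** For fixed s, the coefficients a(i, s) define a polynomial [P] with at most m coefficients. The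
    model with [lam = q ^+ (r + s)], read at row s of column 0, says that [P] vanishes at
    [lam * q ^- s = q ^+ r]. These are m distinct roots, so [P] is zero. *)
Lemma taft_free (a : {ffun 'I_m * 'I_m -> K}) :
  \sum_p a p *: taft_mon p = 0 -> a =1 (fun=> 0).
Proof.
move=> a0 [i0 s].
pose P : {poly K} :=
  \poly_(i < m) (if insub i is Some i' then a (i', s) else 0).
suff P0 : P = 0.
  have := coef_poly m (fun i => if insub i is Some i' then a (i', s) else 0) i0.
  by rewrite ltn_ord valK => <-; rewrite -/P P0 coef0.
have qm := prim_expr_order q_prim.
pose rs := [seq q ^+ r | r <- iota 0 m].
apply: (@roots_geq_poly_eq0 _ _ rs).
- apply/allP => _ /mapP[r _ ->].
  have [m' m'E] : exists m', m = m'.+1 by exists m.-1; rewrite prednK.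
  have lm : (q ^+ (r + s)) ^+ m'.+1 = 1.
    by rewrite -m'E -exprM mulnC exprM qm expr1n.
  have [|H [X [Hm Xm XH HXE]]] := @taft_model K m' q _ _ lm; first by rewrite -m'E.
  have {}Hm : H ^+ m = 1 by rewrite m'E.
  have {}Xm : X ^+ m = 0 by rewrite m'E.
  have [f [[f1 fM] fh fx]] := taft_lift Hm Xm XH.
  have fX u i : f (u ^+ i) = f u ^+ i.
    by elim: i => [|i IH]; rewrite ?expr0 // !exprS fM IH.
  have sm : (s < m'.+1)%N by rewrite -m'E.
  move/(congr1 (fun u => f u (Ordinal sm) 0)): a0.
  rewrite linear0 linear_sum summxE mxE => a0.
  rewrite /root /P horner_poly; apply/eqP; rewrite -[RHS]a0.
  pose F i s' := f (a (i, s') *: taft_mon (i, s')) (Ordinal sm) 0.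
  rewrite [RHS](eq_bigr (fun p => F p.1 p.2)) => [|[]//]; rewrite -pair_bigA /F.
  apply: eq_bigr => i _; rewrite valK (bigD1 s) //= big1 => [|s' /negPf ss'].
    rewrite addr0 linearZ mxE fM !fX fh fx HXE eqxx mul1r.
    by rewrite exprD mulfK // expf_neq0.
  rewrite linearZ mxE fM !fX fh fx HXE /=.
  by rewrite -[s == s' :> nat]/(s == s') eq_sym ss' mul0r mulr0.
- rewrite map_inj_in_uniq ?iota_uniq // => r r'.
  rewrite !mem_iota !add0n => /= rm rm'.
  by move/eqP; rewrite (eq_prim_root_expr q_prim) !modn_small // => /eqP.
- by rewrite size_map size_iota size_poly.
Qed.


Definition taft_coord (p : 'I_m * 'I_m) (u : T) : K := fam_coord taft_span u p.

Lemma taft_coordE u : u = \sum_p taft_coord p u *: (h ^+ p.1 * x ^+ p.2).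
Proof. exact: fam_coordE. Qed.

Lemma taft_coord_is_scalar p : scalar (taft_coord p).
Proof. exact: (fam_coord_is_scalar taft_span taft_free). Qed.

HB.instance Definition _ p :=
  GRing.isLinear.Build K T K *%R (taft_coord p) (taft_coord_is_scalar p).

Lemma taft_coord_mon i s p : (i < m)%N -> (s < m)%N ->
  taft_coord p (h ^+ i * x ^+ s) = ((i == p.1) && (s == p.2))%:R.
Proof.
move=> im sm; rewrite -[_ * _]/(taft_mon (Ordinal im, Ordinal sm)).
by rewrite /taft_coord (fam_coord_e taft_span taft_free).
Qed.

Lemma taft_linP (W : lmodType K) (F G : T -> W) : linear F -> linear G ->
    (forall i s, (i < m)%N -> (s < m)%N ->
       F (h ^+ i * x ^+ s) = G (h ^+ i * x ^+ s)) ->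
  F =1 G.
Proof.
move=> Fl Gl FG u; rewrite (taft_coordE u).
elim/big_rec: _ => [|p v _ IH]; last by rewrite Fl Gl IH FG.
by rewrite -(subrr 0) -scaleN1r addrC Fl Gl !scaleN1r !addNr.
Qed.

Lemma taft_scalarP (F G : T -> K) : scalar F -> scalar G ->
    (forall i s, (i < m)%N -> (s < m)%N ->
       F (h ^+ i * x ^+ s) = G (h ^+ i * x ^+ s)) ->
  F =1 G.
Proof. exact: (@taft_linP K^o). Qed.

(** The endomorphism fixing [h] and multiplying [x] by [b]. The universal property yields it only
    existentially; the coordinate formula makes it a function of [b], and [taft_scaleP] identifies
    the two. *)
Definition taft_scale (b : K) (u : T) : T :=
  \sum_p (taft_coord p u * b ^+ p.2) *: (h ^+ p.1 * x ^+ p.2).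

Lemma taft_scale_is_linear b : linear (taft_scale b).
Proof.
move=> a u v; rewrite /taft_scale scaler_sumr -big_split; apply: eq_bigr => p _.
by rewrite taft_coord_is_scalar mulrDl scalerDl -mulrA -scalerA.
Qed.

HB.instance Definition _ b :=
  GRing.isLinear.Build K T T *:%R (taft_scale b) (taft_scale_is_linear b).

Lemma taft_scaleP b :
  [/\ taft_scale b 1 = 1,
      forall u v, taft_scale b (u * v) = taft_scale b u * taft_scale b v,
      taft_scale b h = h & taft_scale b x = b *: x].
Proof.
have [||f [[f1 fM] fh fx]] := @taft_lift T h (b *: x) taft_hm.
- by rewrite exprZn taft_xm scaler0.
- by rewrite -scalerAl taft_xh -scalerAr !scalerA mulrC.
have fX u i : f (u ^+ i) = f u ^+ i.
  by elim: i => [|i IH]; rewrite ?expr0 // !exprS fM IH.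
suff E : taft_scale b =1 f by split=> [|u v||]; rewrite !E.
move=> u; rewrite [in RHS](taft_coordE u) linear_sum; apply: eq_bigr => p _.
by rewrite linearZ /= fM !fX fh fx exprZn -scalerAr scalerA.
Qed.

Lemma taft_scale1 b : taft_scale b 1 = 1. Proof. by case: (taft_scaleP b). Qed.
Lemma taft_scaleM b u v : taft_scale b (u * v) = taft_scale b u * taft_scale b v.
Proof. by case: (taft_scaleP b). Qed.
Lemma taft_scaleh b : taft_scale b h = h. Proof. by case: (taft_scaleP b). Qed.
Lemma taft_scalex b : taft_scale b x = b *: x.
Proof. by case: (taft_scaleP b). Qed.

Lemma taft_scale_mon b i s :
  taft_scale b (h ^+ i * x ^+ s) = b ^+ s *: (h ^+ i * x ^+ s).
Proof.
have scX u j : taft_scale b (u ^+ j) = taft_scale b u ^+ j.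
  by elim: j => [|j IH]; rewrite ?expr0 ?taft_scale1 // !exprS taft_scaleM IH.
by rewrite taft_scaleM !scX taft_scaleh taft_scalex exprZn -scalerAr.
Qed.

Lemma taft_scale_counit b u : counit (taft_scale b u) = counit u.
Proof.
move: u; apply: taft_scalarP => [||i s _ _]; [by lin | by lin |].
rewrite taft_scale_mon linearZ /= counitM !counitX; have [_ [_ _ -> ->]] := T_taft.
by case: s => [|s]; rewrite ?expr0 ?mul1r // !expr0n /= !mulr0.
Qed.

(** Both sides are multiplicative in [u], so the generators decide; scaling [x] scales both summands
    of its coproduct because [h] and 1 are fixed. *)
Lemma taft_scale_comul b u : comul (taft_scale b u) =
  \tsum_(u1, u2 <- comul u) (taft_scale b u1 \ox taft_scale b u2).
Proof.
have [_ [comul_h comul_x _ _]] := T_taft.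
move: u; apply: taft_ind => [a u v IHu IHv||u IH|u IH].
- by rewrite !linearP IHu IHv.
- by rewrite comul1 taft_scale1 comul1 tlift_tens ?taft_scale1 //; lin.
- rewrite taft_scaleM taft_scaleh !comulM comul_h IH tlift_tmul; try by lin.
  rewrite /tmul !tlift_tens; try by lin.
  rewrite linear_tlift; apply: eq_tlift => u1 u2.
  by rewrite /= tlift_tens ?taft_scaleM ?taft_scaleh //; lin.
- rewrite taft_scaleM taft_scalex !comulM IH tlift_tmul; try by lin.
  rewrite linearZ /= comul_x /tmul [RHS]linearD linearZ linearD /=.
  rewrite !tlift_tens; try by lin.
  rewrite scalerDr; congr (_ + _).
    rewrite !linear_tlift; apply: eq_tlift => u1 u2 /=.
    rewrite tlift_tens ?taft_scaleM ?taft_scaleh ?taft_scalex; try by lin.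
    by rewrite -scalerAl tensZl.
  rewrite !linear_tlift; apply: eq_tlift => u1 u2 /=.
  rewrite tlift_tens ?taft_scaleM ?taft_scale1 ?taft_scalex; try by lin.
  by rewrite -scalerAl tensZr.
Qed.

Section TaftAction.
Context {gT : finGroupType} (chi : gT -> K).
Hypothesis chi1 : chi 1%g = 1.
Hypothesis chiM : forall g g', chi (g * g')%g = chi g * chi g'.

Lemma taft_act1 u : taft_scale (chi 1%g) u = u.
Proof.
move: u; apply: taft_linP => [||i s _ _] //; first by lin.
by rewrite taft_scale_mon chi1 expr1n scale1r.
Qed.

Lemma taft_actM g g' u :
  taft_scale (chi (g * g')%g) u = taft_scale (chi g) (taft_scale (chi g') u).
Proof.
move: u; apply: taft_linP => [||i s _ _]; [by lin | by lin |].
by rewrite !(taft_scale_mon, linearZ) /= taft_scale_mon scalerA chiM exprMn mulrC.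
Qed.

Definition taft_action : hopfAction gT T :=
  @HopfAction K gT T (fun g => taft_scale (chi g)) taft_act1 taft_actM
    (fun g => taft_scale1 (chi g)) (fun g => taft_scaleM (chi g))
    (fun g => taft_scale_comul (chi g)) (fun g => taft_scale_counit (chi g)).

End TaftAction.

(* [eta] and [eps1] are the lower right and upper right entries of the upper
   triangular representation h |-> diag(1, q), x |-> E_12, whose upper left
   entry is the counit. *)
Lemma taft_functionals : exists eta eps1 : {scalar T},
  [/\ eta 1 = 1, forall u v, eta (u * v) = eta u * eta v, eta h = q & eta x = 0] /\
  [/\ forall u v, eps1 (u * v) = counit u * eps1 v + eps1 u * eta v,
      eps1 1 = 0, eps1 h = 0 & eps1 x = 1].
Proof.
have [_ [_ _ counit_h counit_x]] := T_taft.
pose H : 'M[K]_2 := diag_mx (\row_j (if j == 0 then 1 else q)).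
pose X : 'M[K]_2 := delta_mx 0 1.
have X2 : X * X = 0 by rewrite [X * X]mul_delta_mx_0.
have [|||f [[f1 fM] fh fx]] := @taft_lift 'M[K]_2 H X.
- have HX i : H ^+ i = diag_mx (\row_j (if j == 0 then 1 else q) ^+ i).
    elim: i => [|i IH]; apply/matrixP => a b; first by rewrite expr0 !mxE.
    rewrite exprS IH [_ * _]mulmx_diag !mxE exprS.
    by case: (a == b).
  rewrite HX; apply/matrixP => a b; rewrite !mxE.
  by case: ifP => _; rewrite ?expr1n ?(prim_expr_order q_prim).
- by rewrite -(subnK m_ge2) exprD expr2 X2 mulr0.
- rewrite [X * H]mul_mx_diag [H * X]mul_diag_mx; apply/matrixP => a b.
  rewrite !mxE; case: andP => [[/eqP-> /eqP->]|_]; rewrite /= ?mul0r ?mulr0 //.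
  by rewrite !mul1r mulr1.
have entry_lin i j : scalar (fun u => f u i j).
  by move=> a u v; rewrite linearP !mxE.
pose ent i j := HB.pack_for {scalar T} (fun u => f u i j)
  (GRing.isLinear.Build K T K *%R _ (entry_lin i j)).
have fME u v i j : f (u * v) i j = f u i 0 * f v 0 j + f u i 1 * f v 1 j.
  rewrite fM mxE big_ord_recl big_ord1.
  by congr (_ + f u i _ * f v _ j); apply: val_inj.
have low : forall u, f u 1 0 = 0 /\ f u 0 0 = counit u.
  apply: taft_ind => [a u v [u1 u2] [v1 v2]||u [u1 u2]|u [u1 u2]].
  - by rewrite linearP !mxE u1 u2 v1 v2 linearP mulr0 addr0.
  - by rewrite f1 !mxE counit1.
  - by rewrite !fME fh !mxE u1 u2 counitM counit_h /= !mul0r !mulr0 !addr0.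
  - by rewrite !fME fx !mxE u1 u2 counitM counit_x /= !mul0r !mulr0 !addr0.
exists (ent 1 1), (ent 0 1); split; split=> /=.
- by rewrite f1 !mxE.
- by move=> u v; rewrite fME (low u).1 mul0r add0r.
- by rewrite fh !mxE.
- by rewrite fx !mxE.
- by move=> u v; rewrite fME (low u).2.
- by rewrite f1 !mxE.
- by rewrite fh !mxE.
- by rewrite fx !mxE.
Qed.

Section TaftOperators.
Variables eta eps1 : {scalar T}.
Hypotheses (eta1 : eta 1 = 1) (etaM : forall u v, eta (u * v) = eta u * eta v).
Hypotheses (eta_h : eta h = q) (eta_x : eta x = 0).
Hypotheses (eps1M : forall u v, eps1 (u * v) = counit u * eps1 v + eps1 u * eta v).
Hypotheses (eps1_1 : eps1 1 = 0) (eps1_h : eps1 h = 0) (eps1_x : eps1 x = 1).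

(* [conv_op eta] is diagonal on the monomials and [conv_op eps1] is the
   q-derivation killing [h] and mapping [x] to [h]; on a grouplike or skew
   primitive element they turn the shape of the coproduct into linear equations. *)
Definition conv_op (f : {scalar T}) (u : T) : T :=
  \tsum_(u1, u2 <- comul u) f u1 *: u2.

Lemma conv_op_is_linear f : linear (conv_op f).
Proof. by rewrite /conv_op; lin. Qed.

HB.instance Definition _ f :=
  GRing.isLinear.Build K T T *:%R (conv_op f) (conv_op_is_linear f).

Local Notation N := (conv_op eta).
Local Notation D := (conv_op eps1).

Lemma conv_op_tens f u a b : comul u = a \ox b -> conv_op f u = f a *: b.
Proof. by move=> cu; rewrite /conv_op cu tlift_tens //; lin. Qed.

Lemma conv_op_tens2 f u a b a' b' : comul u = a \ox b + a' \ox b' ->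
  conv_op f u = f a *: b + f a' *: b'.
Proof. by move=> cu; rewrite /conv_op cu linearD /= !tlift_tens //; lin. Qed.

Lemma convM_eta u v : N (u * v) = N u * N v.
Proof.
rewrite /conv_op comulM tlift_tmul; try by lin.
rewrite -tlift_prod; apply: eq_tlift => a b; apply: eq_tlift => a' b'.
by rewrite etaM -scalerAl -scalerAr scalerA.
Qed.

(** [eps1] is a derivation from [counit] to [eta], and so [D] is a derivation twisted by the algebra
    map [N]. *)
Lemma convM_eps1 u v : D (u * v) = u * D v + D u * N v.
Proof.
(* The isolated [u] is expanded by the counit law, so that both terms become sums over the coproduct
   of [u]. *)
rewrite -{2}[u]counitl /conv_op comulM tlift_tmul; try by lin.
rewrite -!tlift_prod -[LHS]scale1r -[X in _ = X + _]scale1r -tlift_funP scale1r.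
apply: eq_tlift => a b; rewrite -tlift_funP; apply: eq_tlift => a' b'.
by rewrite eps1M scale1r scalerDl -!scalerAl -!scalerAr !scalerA.
Qed.

Lemma conv_eta_h : N h = q *: h.
Proof. by have [_ [ch _ _ _]] := T_taft; rewrite (conv_op_tens _ ch) eta_h. Qed.

Lemma conv_eta_x : N x = x.
Proof.
have [_ [_ cx _ _]] := T_taft; rewrite (conv_op_tens2 _ cx) eta_x eta1.
by rewrite scale0r add0r scale1r.
Qed.

Lemma conv_eta1 : N 1 = 1.
Proof. by rewrite (conv_op_tens _ comul1) eta1 scale1r. Qed.

Lemma conv_eps1_h : D h = 0.
Proof.
by have [_ [ch _ _ _]] := T_taft; rewrite (conv_op_tens _ ch) eps1_h scale0r.
Qed.

Lemma conv_eps1_x : D x = h.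
Proof.
have [_ [_ cx _ _]] := T_taft; rewrite (conv_op_tens2 _ cx) eps1_x eps1_1.
by rewrite scale0r addr0 scale1r.
Qed.

Lemma conv_eps1_1 : D 1 = 0.
Proof. by rewrite (conv_op_tens _ comul1) eps1_1 scale0r. Qed.

Lemma conv_eta_mon i s : N (h ^+ i * x ^+ s) = q ^+ i *: (h ^+ i * x ^+ s).
Proof.
have NX u j : N (u ^+ j) = N u ^+ j.
  by elim: j => [|j IH]; rewrite ?expr0 ?conv_eta1 // !exprS convM_eta IH.
by rewrite convM_eta !NX conv_eta_h conv_eta_x exprZn -scalerAl.
Qed.

(** The coefficient is the q-integer of s, produced by moving [h] to the left of the powers of [x].
    At s = 0 the empty sum makes the truncated [s.-1] harmless. *)
Lemma conv_eps1_mon i s : D (h ^+ i * x ^+ s) =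
  (\sum_(j < s) q ^+ j) *: (h ^+ i.+1 * x ^+ s.-1).
Proof.
elim: i => [|i IH]; last first.
  rewrite exprS -mulrA convM_eps1 IH conv_eps1_h mul0r addr0 -scalerAr mulrA.
  by rewrite -!exprS.
rewrite expr0 mul1r expr1; elim: s => [|s IH].
  by rewrite conv_eps1_1 big_ord0 scale0r.
have NX j : N (x ^+ j) = x ^+ j.
  by have := conv_eta_mon 0 j; rewrite !expr0 mul1r scale1r.
rewrite exprS convM_eps1 IH conv_eps1_x NX -scalerAr mulrA taft_xh.
rewrite -scalerAl -mulrA scalerA big_ord_recl expr0 /=.
case: s IH => [|s] IH.
  by rewrite !big_ord0 mul0r scale0r add0r addr0 scale1r.
rewrite -exprS addrC scalerDl scale1r mulrC mulr_sumr.
by under [in RHS]eq_bigr do rewrite exprS.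
Qed.

(** Multiplied by q - 1 the sum becomes q^s - 1, nonzero because q has order m > s. *)
Lemma qnum_neq0 s : (0 < s < m)%N -> \sum_(j < s) q ^+ j != 0.
Proof.
case/andP=> s0 sm; apply/eqP=> qs.
have := subrX1 q s; rewrite qs mulr0 => /eqP.
by rewrite subr_eq0 -(prim_order_dvd q_prim) gtnNdvd.
Qed.

(** [D] raises the exponent of [h] by one, and the eigenvalues of [N] record that exponent. *)
Lemma conv_qcomm u : N (D u) = q *: D (N u).
Proof.
move: u; apply: taft_linP => [||i s _ _]; [by lin | by lin |].
rewrite conv_eta_mon conv_eps1_mon !linearZ /= conv_eta_mon conv_eps1_mon.
by rewrite !scalerA mulrC exprSr.
Qed.

Lemma coord_conv_eta p u : taft_coord p (N u) = q ^+ p.1 * taft_coord p u.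
Proof.
move: u; apply: taft_scalarP => [||i s im sm]; [by lin | by lin |].
rewrite conv_eta_mon linearZ /= taft_coord_mon //.
by case: eqP => [->|]; rewrite ?mulr0.
Qed.

Lemma conv_eta_inj u : N u = 0 -> u = 0.
Proof.
move=> Nu; rewrite (taft_coordE u) big1 // => p _.
have /eqP := coord_conv_eta p u; rewrite Nu linear0 eq_sym mulf_eq0.
by rewrite (negPf (expf_neq0 _ q_neq0)) /= => /eqP->; rewrite scale0r.
Qed.

(** [D] sends the monomials with a positive power of [x] to nonzero multiples of distinct monomials.
    The exponent of [h] is shifted cyclically modulo m, hence the reduction in [p']. *)
Lemma coord_ker_eps1 u (p : 'I_m * 'I_m) :
  D u = 0 -> (0 < p.2)%N -> taft_coord p u = 0.
Proof.
move=> Du p2; case: p p2 => i0 s0 /= s0_gt0.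
have s0m : (s0.-1 < m)%N by apply: leq_ltn_trans (leq_pred _) (ltn_ord s0).
pose p' := (Ordinal (ltn_pmod i0.+1 m_gt0), Ordinal s0m).
suff E : taft_coord p' (D u) = (\sum_(j < s0) q ^+ j) * taft_coord (i0, s0) u.
  move/eqP: E; rewrite Du linear0 eq_sym mulf_eq0.
  by rewrite (negPf (qnum_neq0 _)) ?s0_gt0 //= => /eqP.
move: u {Du}; apply: taft_scalarP => [||i s im sm]; [by lin | by lin |].
rewrite conv_eps1_mon linearZ /= taft_hX !taft_coord_mon ?ltn_pmod //=; last first.
  exact: leq_ltn_trans (leq_pred _) sm.
case: s sm => [|s] sm; first by rewrite big_ord0 mul0r (ltn_eqF s0_gt0) andbF mulr0.
have -> : (s.+1 == s0) = (s == s0.-1) by rewrite -{1}(prednK s0_gt0) eqSS.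
have -> : (i.+1 == i0.+1 %[mod m])%N = (i == i0).
  by rewrite -[i.+1]addn1 -[i0.+1]addn1 eqn_modDr !modn_small.
rewrite /=; case: (s =P s0.-1) => [->|_]; last by rewrite andbF !mulr0.
by rewrite prednK.
Qed.

Lemma ker_eps1_comm u : D u = 0 -> u * h = h * u.
Proof.
move=> Du; rewrite (taft_coordE u) mulr_suml mulr_sumr; apply: eq_bigr => -[i s] _.
case: (posnP s) => /= [->|s0]; last first.
  by rewrite (coord_ker_eps1 Du) // !scale0r mul0r mulr0.
by rewrite expr0 mulr1 -scalerAl -scalerAr -exprSr exprS.
Qed.

(** The kernel of [D] lies in K[h], where [N] has the distinct eigenvalues q^i on the h^i; only the
    multiple of h^j survives, and the counit gives its coefficient. *)
Lemma ker_eps1_eigen u j : D u = 0 -> N u = q ^+ j *: u -> (j < m)%N ->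
  u = counit u *: h ^+ j.
Proof.
move=> Du Nu jm; have [_ [_ _ counit_h _]] := T_taft.
suff E : u = taft_coord (Ordinal jm, Ordinal m_gt0) u *: h ^+ j.
  by rewrite [in RHS]E linearZ /= counitX counit_h expr1n mulr1 -E.
rewrite [LHS](taft_coordE u) (bigD1 (Ordinal jm, Ordinal m_gt0)) //= expr0 mulr1.
rewrite big1 ?addr0 // => -[i s] ij /=.
suff -> : taft_coord (i, s) u = 0 by rewrite scale0r.
case: (posnP s) => [s0|]; last exact: (@coord_ker_eps1 u (i, s) Du).
have := coord_conv_eta (i, s) u; rewrite Nu linearZ /= => /eqP.
rewrite -subr_eq0 -mulrBl mulf_eq0 subr_eq0 (eq_prim_root_expr q_prim).
rewrite !modn_small // => /orP[/eqP ji|/eqP //].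
by case/eqP: ij; congr (_, _); apply: val_inj.
Qed.

(** * How a single group element acts on the generators and is acted upon *)

Section MatchedPairClassification.
Context {gT : finGroupType} (mp : matchedPair T (groupAlg K gT)) (g : gT).
Local Notation ag a := (gelt g |>[mp] a).
Local Notation rg a := (gelt g <|[mp] a).

Lemma mp_lact_inj : injective (fun a => ag a).
Proof.
have [lact1 lactM _ _] := mp_lmodcoalg mp.
move=> a b /(congr1 (fun u => gelt g^-1%g |>[mp] u)).
by rewrite -!lactM geltM mulVg !lact1.
Qed.

Lemma mp_lact_one : ag 1 = 1.
Proof. by rewrite mp_lact1 counit_gelt scale1r. Qed.

Lemma mp_lact_h_comul : comul (ag h) = ag h \ox ag h.
Proof.
have [_ _ -> _] := mp_lmodcoalg mp; have [_ [-> _ _ _]] := T_taft.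
by rewrite comul_gelt !tlift_tens //; lin.
Qed.

Lemma mp_lact_x_comul : comul (ag x) = ag x \ox ag h + 1 \ox ag x.
Proof.
have [_ _ -> _] := mp_lmodcoalg mp; have [_ [_ -> _ _]] := T_taft.
rewrite comul_gelt !tlift_tens; try by lin.
by rewrite linearD /= !tlift_tens ?mp_lact_one //; lin.
Qed.

Lemma mp_counit_lact_h : counit (ag h) = 1.
Proof.
have [_ _ _ ->] := mp_lmodcoalg mp; have [_ [_ _ -> _]] := T_taft.
by rewrite counit_gelt mulr1.
Qed.

(** For the grouplike u = [ag h], N u = eta(u) u and D u = eps1(u) u, so N D = q D N reads eta(u)
    eps1(u) (1 - q) u = 0. Here u is nonzero by its counit, and eta(u) is nonzero because [N] is
    injective. *)
Lemma mp_lact_h_eps1 : D (ag h) = 0.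
Proof.
have cu := mp_lact_h_comul.
have Nu := conv_op_tens eta cu; have Du := conv_op_tens eps1 cu.
have u0 : ag h != 0.
  apply/eqP => u0; have := mp_counit_lact_h; rewrite u0 linear0 => /esym/eqP.
  by rewrite oner_eq0.
have etau : eta (ag h) != 0.
  apply/eqP => e0; case/eqP: u0; apply: conv_eta_inj.
  by rewrite Nu e0 scale0r.
have /eqP := conv_qcomm (ag h).
rewrite Nu Du !linearZ /= Nu Du !scalerA -subr_eq0 -scalerBl scaler_eq0.
rewrite (negPf u0) orbF [eps1 _ * _]mulrC -mulrBl.
rewrite -{1}[eta _]mulr1 -mulrBr !mulf_eq0 (negPf etau) subr_eq0 eq_sym.
by rewrite (negPf q_neq1) /= => /eqP->; rewrite scale0r.
Qed.

(** The second conclusion serves the first: with y = [ag x] and u = [ag h], the relation N D = q D N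
    at y gives eps1(y) (eta(u) - q) u = 0. Once eps1(y) is nonzero, u is the element of ker D with
    eigenvalue q and counit 1, that is, [h]. *)
Lemma mp_lact_h : ag h = h /\ eps1 (ag x) != 0.
Proof.
have cu := mp_lact_h_comul; have Du := mp_lact_h_eps1.
have Nu := conv_op_tens eta cu.
have Ny : N (ag x) = eta (ag x) *: ag h + ag x.
  by rewrite (conv_op_tens2 _ mp_lact_x_comul) eta1 scale1r.
have Dy : D (ag x) = eps1 (ag x) *: ag h.
  by rewrite (conv_op_tens2 _ mp_lact_x_comul) eps1_1 scale0r addr0.
have u0 : ag h != 0.
  apply/eqP => u0; have := mp_counit_lact_h; rewrite u0 linear0 => /esym/eqP.
  by rewrite oner_eq0.
(* Otherwise [ag x] is a combination of 1 and [ag h], hence [x] one of 1, [h]. *)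
have y0 : eps1 (ag x) != 0.
  apply/eqP => y0; rewrite y0 scale0r in Dy.
  (* If eta(u) = 1, then u is a scalar of counit 1, so u = 1 = [ag 1] and h = 1 by injectivity,
     against eta(h) = q. *)
  have [e1|e1] := eqVneq (eta (ag h)) 1.
    have : ag h = counit (ag h) *: h ^+ 0.
      by apply: ker_eps1_eigen => //; rewrite Nu e1 expr0.
    rewrite mp_counit_lact_h expr0 scale1r -mp_lact_one => /mp_lact_inj h1.
    by move/eqP: q_neq1; apply; rewrite -eta_h h1.
  (* From N y = eta(y) u + y and N u = eta(u) u, this [a] makes y - a u fixed by [N]. It is also
     killed by [D], hence a scalar. *)
  pose a := eta (ag x) / (eta (ag h) - 1); pose w := ag x - a *: ag h.
  have wE : w = counit w *: h ^+ 0.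
    apply: ker_eps1_eigen => //; rewrite /w linearB linearZ /=.
      by rewrite Dy Du scaler0 subr0.
    rewrite Ny Nu expr0 scale1r addrAC addrC; congr (_ + _).
    rewrite scalerA -scalerBl -scaleNr; congr (_ *: _).
    apply: (mulIf (x := eta (ag h) - 1)); first by rewrite subr_eq0.
    rewrite mulrBl mulrAC /a divfK ?subr_eq0 // mulNr divfK ?subr_eq0 //.
    by rewrite mulrBr mulr1 addrAC subrr add0r.
  have : ag x = ag (counit w *: 1 + a *: h).
    rewrite tensDr !tensZr linearP linearZ /= mp_lact_one.
    by move: wE; rewrite expr0 => <-; rewrite subrK.
  move=> /mp_lact_inj xE; have /eqP := eps1_x.
  rewrite xE linearD !linearZ /= eps1_1 eps1_h !mulr0 addr0 eq_sym.
  by rewrite oner_eq0.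
split=> //.
have etau : eta (ag h) = q.
  have /eqP := conv_qcomm (ag x); rewrite Ny linearD linearZ /= Du Dy linearZ /= Nu.
  rewrite scaler0 add0r !scalerA -subr_eq0 -scalerBl scaler_eq0 (negPf u0) orbF.
  by rewrite [q * _]mulrC -mulrBr mulf_eq0 (negPf y0) subr_eq0 => /eqP.
have := @ker_eps1_eigen (ag h) 1 Du; rewrite mp_counit_lact_h expr1 scale1r.
by apply; rewrite // Nu etau.
Qed.

(** At (g, x) the swap axiom reads rg x (x) h + g (x) ag x = rg h (x) ag x + rg x (x) 1. Pairing the
    second factor with [eps1] kills h and 1 and leaves a nonzero multiple of g = rg h; [eta] then
    gives (q - 1) rg x = 0. *)
Lemma mp_ract_gen : rg h = gelt g /\ rg x = 0.
Proof.
have [uh y0] := mp_lact_h; have [r1 _ _ _] := mp_rmodcoalg mp.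
have [_ [_ cx _ _]] := T_taft.
have := mp_swap mp (gelt g) x; rewrite comul_gelt cx.
rewrite !tlift_tens; try by lin.
rewrite !linearD /= !tlift_tens; try by lin.
rewrite r1 mp_lact_one uh => E.
have E1 (f : {scalar T}) : f h *: rg x + f (ag x) *: gelt g =
    f (ag x) *: rg h + f 1 *: rg x.
  move/(congr1 (tlift (fun (a : groupAlg K gT) b => f b *: a))): E.
  by rewrite !linearD /= !tlift_tens //; lin.
have rh : rg h = gelt g.
  have := E1 eps1; rewrite eps1_h eps1_1 !scale0r add0r addr0.
  by move/(scalerI y0).
split=> //; have := E1 eta; rewrite rh eta_h eta1 addrC => /addrI/eqP.
rewrite -subr_eq0 -scalerBl scaler_eq0 subr_eq0 (negPf q_neq1).
by move/eqP.
Qed.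

Lemma mp_ractE a : rg a = counit a *: gelt g.
Proof.
have [rh rx] := mp_ract_gen; have [r1 rM _ _] := mp_rmodcoalg mp.
have [_ [_ _ ch cx]] := T_taft.
move: a; apply: taft_ind => [b u v ru rv||u ru|u ru].
- by rewrite tensDr tensZr !linearP /= ru rv scalerDl scalerA.
- by rewrite r1 counit1 scale1r.
- by rewrite rM rh ru counitM ch mul1r.
- rewrite rM rx counitM cx mul0r -[0 in LHS](scale0r (0 : groupAlg K gT)) tensZl.
  by rewrite linearZ /= !scale0r.
Qed.

Lemma mp_lact_mul a b : ag (a * b) = ag a * ag b.
Proof.
rewrite mp_lactM comul_gelt tlift_tens; try by lin.
rewrite -[RHS](@tlift_counitr _ _ _ (fun a => ag a * ag b)); last by lin.
apply: eq_tlift => a1 a2.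
by rewrite mp_ractE tensZl linearZ /= scalerAr.
Qed.

(** The difference [w] lies in ker D, so it commutes with [h]. It also satisfies w h = q h w, as
    both [ag x] and [x] do, hence h w = 0, and [h] is invertible. *)
Lemma mp_lact_x : ag x = eps1 (ag x) *: x.
Proof.
have [uh y0] := mp_lact_h.
pose w := ag x - eps1 (ag x) *: x.
have Dw : D w = 0.
  rewrite linearB linearZ /= (conv_op_tens2 _ mp_lact_x_comul) eps1_1 scale0r.
  by rewrite addr0 uh conv_eps1_x subrr.
have wh : w * h = q *: (h * w).
  have yh : ag x * h = q *: (h * ag x).
    by rewrite -{1 2}uh -!mp_lact_mul taft_xh tensZr linearZ.
  by rewrite mulrBl mulrBr scalerBr yh -scalerAl -scalerAr taft_xh !scalerA mulrC.
have hw : h * w = 0.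
  move/eqP: wh; rewrite (ker_eps1_comm Dw) -subr_eq0 -{1}[h * w]scale1r -scalerBl.
  by rewrite scaler_eq0 subr_eq0 eq_sym (negPf q_neq1) => /eqP.
apply/eqP; rewrite -subr_eq0 -/w -[w]mul1r -taft_hm -(prednK m_gt0) exprSr.
by rewrite -mulrA hw mulr0.
Qed.

End MatchedPairClassification.

End TaftOperators.

Lemma taft_x_neq0 : x != 0.
Proof.
have [eta [eps1 [_ [_ _ _ ex]]]] := taft_functionals.
by apply/eqP=> x0; move/eqP: ex; rewrite x0 linear0 eq_sym oner_eq0.
Qed.

Lemma taft_scale_uniq (F : T -> T) b : linear F -> F 1 = 1 ->
    (forall u v, F (u * v) = F u * F v) -> F h = h -> F x = b *: x ->
  F =1 taft_scale b.
Proof.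
move=> Fl F1 FM Fh Fx; apply: taft_linP => [||i s _ _] //; first by lin.
have FX u j : F (u ^+ j) = F u ^+ j.
  by elim: j => [|j IH]; rewrite ?expr0 // !exprS FM IH.
by rewrite taft_scale_mon FM !FX Fh Fx exprZn -scalerAr.
Qed.

Lemma taft_matchedPair_char (gT : finGroupType)
    (mp : matchedPair T (groupAlg K gT)) :
  exists chi : gT -> K,
    [/\ chi 1%g = 1, forall g g', chi (g * g')%g = chi g * chi g',
        forall g u, gelt g |>[mp] u = taft_scale (chi g) u &
        forall g u, gelt g <|[mp] u = counit u *: gelt g].
Proof.
have [eta [eps1 [[e1 eM eh ex] [f1 fM fh fx]]]] := taft_functionals.
pose chi g := eps1 (gelt g |>[mp] x).
have lx g : gelt g |>[mp] x = chi g *: x.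
  exact: (mp_lact_x e1 eM eh ex f1 fM fh fx mp g).
have [lact1 lactM _ _] := mp_lmodcoalg mp.
exists chi; split.
- by rewrite /chi lact1.
- move=> g g'; rewrite {1}/chi -geltM lactM lx tensZr linearZ /= lx scalerA.
  by rewrite linearZ /= fx mulr1 mulrC.
- move=> g; apply: taft_scale_uniq => //.
  + by lin.
  + exact: (mp_lact_one mp g).
  + exact: (mp_lact_mul e1 eM eh ex f1 fM fh fx mp g).
  + by have [] := mp_lact_h e1 eM eh ex f1 fM fh fx mp g.
- exact: (mp_ractE e1 eM eh ex f1 fM fh fx mp).
Qed.

End Taft.

(** * The presentation of the skew group algebra *)

Section NormalForms.
Context {K : fieldType} {R : lalgType K} {rels : seq R}.
Hypothesis scaleAr : forall a (u v : R), a *: (u * v) = u * (a *: v).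
Context {C D H X : R} {k l m n : nat} {q beta sigma : K}.
Local Notation "u === v" := (eqmod rels u v) (at level 70).
Hypotheses (l_gt0 : (0 < l)%N) (n_gt0 : (0 < n)%N) (m_gt0 : (0 < m)%N).
Hypotheses (Cl : C ^+ l === 1) (Dn : D ^+ n === 1) (Hm : H ^+ m === 1).
Hypotheses (Xm : X ^+ m === 0) (CH : C * H === H * C) (DH : D * H === H * D).
Hypotheses (CD : C * D === D ^+ k * C) (CX : C * X === beta *: (X * C)).
Hypotheses (DX : D * X === sigma *: (X * D)) (XH : X * H === q *: (H * X)).

(** Here [C], [D], [H], [X] are any elements satisfying the relations modulo [rels]; congruences
    take the place of a quotient algebra. *)
Definition normal_form a b t i : R := H ^+ a * X ^+ b * D ^+ t * C ^+ i.

Local Notation nf := normal_form.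

Lemma nf_mod a b t i : nf a b t i === nf (a %% m) b (t %% n) (i %% l).
Proof.
rewrite /normal_form; apply: eqmod_trans (eqmodMl _ (eqmod_exp_modn i l_gt0 Cl)) _.
apply/eqmodMr/(eqmod_trans (eqmodMl _ (eqmod_exp_modn t n_gt0 Dn))).
by apply/eqmodMr/eqmodMr/eqmod_exp_modn.
Qed.

Lemma nf_ge a b t i : (m <= b)%N -> nf a b t i === 0.
Proof.
move=> mb; rewrite /normal_form -(subnKC mb) exprD.
rewrite -[X in _ === X](mul0r (C ^+ i)) -[X in _ === X * _](mul0r (D ^+ t)).
apply/eqmodMr/eqmodMr; rewrite -[X in _ === X](mulr0 (H ^+ a)); apply: eqmodMl.
by rewrite -[X in _ === X](mul0r (X ^+ (b - m))); apply: eqmodMr.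
Qed.

Lemma nf_mulH a b t i : H * nf a b t i = nf a.+1 b t i.
Proof. by rewrite /normal_form !mulrA -exprS. Qed.

Lemma nf_mulX a b t i : X * nf a b t i === q ^+ a *: nf a b.+1 t i.
Proof.
have -> : X * nf a b t i = X * H ^+ a * (X ^+ b * (D ^+ t * C ^+ i)).
  by rewrite /normal_form !mulrA.
have -> : q ^+ a *: nf a b.+1 t i =
    q ^+ a *: (H ^+ a * X) * (X ^+ b * (D ^+ t * C ^+ i)).
  by rewrite /normal_form exprS -scalerAl !mulrA.
exact/eqmodMr/eqmod_commX.
Qed.

Lemma eqmod_commX1 u v a : u * v === v * u -> u * v ^+ a === v ^+ a * u.
Proof.
move=> uv; have := @eqmod_commX _ _ rels 1 u v a scaleAr.
by rewrite expr1n !scale1r; apply.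
Qed.

Lemma nf_mulD a b t i : D * nf a b t i === sigma ^+ b *: nf a b t.+1 i.
Proof.
have -> : D * nf a b t i = D * H ^+ a * (X ^+ b * (D ^+ t * C ^+ i)).
  by rewrite /normal_form !mulrA.
apply: eqmod_trans (eqmodMr _ (eqmod_commX1 _ DH)) _; rewrite -mulrA mulrA.
have -> : sigma ^+ b *: nf a b t.+1 i =
    H ^+ a * (sigma ^+ b *: (X ^+ b * D) * (D ^+ t * C ^+ i)).
  by rewrite /normal_form exprS -scalerAl -scaleAr !mulrA.
by rewrite -mulrA (mulrA D); apply/eqmodMl/eqmodMr/eqmod_commX.
Qed.

Lemma eqmod_CD t : C * D ^+ t === D ^+ (k * t) * C.
Proof.
elim: t => [|t IH]; first by rewrite muln0 !expr0 mulr1 mul1r; apply: eqmod_refl.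
rewrite exprSr mulrA; apply: eqmod_trans (eqmodMr _ IH) _.
by rewrite mulnS addnC exprD -!mulrA; apply: eqmodMl.
Qed.

(** [C] commutes with [H], picks up [beta] at each [X], and turns [D ^+ t] into [D ^+ (k * t)]. *)
Lemma nf_mulC a b t i : C * nf a b t i === beta ^+ b *: nf a b (k * t) i.+1.
Proof.
have -> : C * nf a b t i = C * H ^+ a * (X ^+ b * (D ^+ t * C ^+ i)).
  by rewrite /normal_form !mulrA.
apply: eqmod_trans (eqmodMr _ (eqmod_commX1 _ CH)) _.
have -> : beta ^+ b *: nf a b (k * t) i.+1 =
    H ^+ a * (beta ^+ b *: (X ^+ b * (D ^+ (k * t) * C * C ^+ i))).
  by rewrite /normal_form exprS -scaleAr !mulrA.
rewrite -mulrA (mulrA C); apply: eqmodMl.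
apply: eqmod_trans (eqmodMr _ (eqmod_commX _ scaleAr CX)) _.
have -> : beta ^+ b *: (X ^+ b * C) * (D ^+ t * C ^+ i) =
    beta ^+ b *: (X ^+ b * (C * D ^+ t * C ^+ i)) by rewrite -scalerAl !mulrA.
by apply/eqmodZ/eqmodMl/eqmodMr/eqmod_CD.
Qed.

End NormalForms.

Section Presentation.
Context {K : fieldType} {m : nat} {q : K} {k l n : nat}.
Context {T : hopfAlgType K} {h x : T} {gT : finGroupType} {c d : gT}.
Hypotheses (m_ge2 : (2 <= m)%N) (q_prim : m.-primitive_root q).
Hypotheses (l_gt0 : (0 < l)%N) (n_gt0 : (0 < n)%N).
Hypothesis (kl_mod_n : (k ^ l = 1 %[mod n])%N).
Hypotheses (T_taft : is_taft m q h x) (gT_D : is_Dlnk k l n c d).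
Context {phi : hopfAction gT T} {beta sigma : K}.
Hypotheses (phi_h : forall g, phi g h = h).
Hypotheses (phi_c : phi c x = beta *: x) (phi_d : phi d x = sigma *: x).
Local Notation B := (skewGroupAlg phi).
Local Notation coord := (taft_coord m_ge2 T_taft).
Local Notation code := (Dlnk_code l_gt0 n_gt0 gT_D).

Let m_gt0 : (0 < m)%N. Proof. exact: ltnW. Qed.

Let cB : B := single c 1.
Let dB : B := single d 1.
Let hB : B := single 1%g h.
Let xB : B := single 1%g x.

Lemma hactX g u i : phi g (u ^+ i) = phi g u ^+ i.
Proof. by elim: i => [|i IH]; rewrite ?expr0 ?hact_one // !exprS hact_mul IH. Qed.

Lemma hact_mon g b i s : phi g x = b *: x ->
  phi g (h ^+ i * x ^+ s) = b ^+ s *: (h ^+ i * x ^+ s).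
Proof. by move=> gx; rewrite hact_mul !hactX phi_h gx exprZn -scalerAr. Qed.

Lemma single_eltX g i : (single g 1 : B) ^+ i = single (g ^+ i)%g 1.
Proof.
elim: i => [|i IH]; first by rewrite expr0 expg0.
by rewrite exprS expgS IH singleM hact_one mulr1.
Qed.

Lemma single_oneX u i : (single 1%g u : B) ^+ i = single 1%g (u ^+ i).
Proof.
elim: i => [|i IH]; first by rewrite !expr0.
by rewrite !exprS IH singleM hact1 mulg1.
Qed.

Lemma single_nf i s t j : hB ^+ i * xB ^+ s * dB ^+ t * cB ^+ j =
  single (d ^+ t * c ^+ j)%g (h ^+ i * x ^+ s).
Proof.
rewrite !single_eltX !single_oneX !singleM !hact1 !hact_one.
by rewrite !mulr1 !mul1g.
Qed.

Lemma skew_nf_ind (P : B -> Prop) :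
    (forall a u w, P u -> P w -> P (a *: u + w)) ->
    (forall i s t j, P (single (d ^+ t * c ^+ j)%g (h ^+ i * x ^+ s))) ->
  forall u, P u.
Proof.
move=> PZD Pnf u.
have P0 : P 0.
  by have := PZD (-1) _ _ (Pnf 0 0 0 0)%N (Pnf 0 0 0 0)%N; rewrite scaleN1r addNr.
rewrite (skewE u); elim/big_rec: _ => // g v _ Pv.
rewrite (taft_coordE m_ge2 T_taft (u g)) linear_sum.
elim/big_rec: _ => [|p w _ Pw]; first by rewrite add0r.
rewrite linearZ -addrA; apply: PZD => //.
by have [[t j] ->] := Dlnk_nf_surj l_gt0 n_gt0 gT_D g; apply: Pnf.
Qed.

(** * A section of the evaluation map, built on normal forms *)

Section SectionMap.
Context {R : lalgType K} {rels : seq R}.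
Hypothesis scaleAr : forall a (u v : R), a *: (u * v) = u * (a *: v).
Context {C D H X : R}.
Local Notation "u === v" := (eqmod rels u v) (at level 70).
Hypotheses (Cl : C ^+ l === 1) (Dn : D ^+ n === 1) (Hm : H ^+ m === 1).
Hypotheses (Xm : X ^+ m === 0) (CH : C * H === H * C) (DH : D * H === H * D).
Hypotheses (CD : C * D === D ^+ k * C) (CX : C * X === beta *: (X * C)).
Hypotheses (DX : D * X === sigma *: (X * D)) (XH : X * H === q *: (H * X)).
Local Notation nf := (@normal_form K R C D H X).

Lemma coord0 p : coord p 0 = 0.
Proof.
have := taft_coord_is_scalar m_ge2 q_prim T_taft p (-1) 0 0.
by rewrite scaler0 addr0 mulN1r addNr.
Qed.

(* A linear section of the evaluation at the generators of [B]. Modulo the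
   relators it commutes with left multiplication by each generator, so every
   noncommutative polynomial is congruent to the section of its value. *)
Definition nf_section (b : B) : R :=
  \sum_g \sum_p coord p (b g) *: nf p.1 p.2 (code g).1 (code g).2.

Lemma nf_section_is_linear : linear nf_section.
Proof.
move=> a u v; rewrite /nf_section scaler_sumr -big_split; apply: eq_bigr => g _.
rewrite scaler_sumr -big_split; apply: eq_bigr => p _ /=.
by rewrite !ffunE (taft_coord_is_scalar m_ge2 q_prim) scalerDl scalerA.
Qed.

Lemma nf_section0 : nf_section 0 = 0.
Proof.
by have := nf_section_is_linear (-1) 0 0; rewrite scaler0 addr0 scaleN1r addNr.
Qed.

Lemma nf_section_single g u : nf_section (single g u) =
  \sum_p coord p u *: nf p.1 p.2 (code g).1 (code g).2.
Proof.
rewrite /nf_section (bigD1 g) //= [X in _ + X]big1 => [|g' /negPf gg'].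
  by rewrite addr0; apply: eq_bigr => p _; rewrite ffunE eqxx.
by rewrite big1 // => p _; rewrite ffunE gg' coord0 scale0r.
Qed.

(** The exponents are unrestricted: [nf_mod] reduces those of [h], [d] and [c], and for s >= m both
    sides vanish modulo the ideal. Multiplying by a generator thus needs no overflow cases. *)
Lemma nf_section_nf i s t j :
  nf_section (single (d ^+ t * c ^+ j)%g (h ^+ i * x ^+ s)) === nf i s t j.
Proof.
rewrite nf_section_single (Dlnk_code_nf l_gt0 n_gt0 kl_mod_n) /=.
case: (ltnP s m) => sm; last first.
  rewrite (taft_xX T_taft sm) mulr0 big1 => [|p _].
    by apply: eqmod_sym; apply: (nf_ge Xm _ _ _ sm).
  by rewrite coord0 scale0r.
rewrite (taft_hX T_taft) (bigD1 (Ordinal (ltn_pmod i m_gt0), Ordinal sm)) //=.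
rewrite (taft_coord_mon m_ge2 q_prim) ?ltn_pmod //= !eqxx scale1r.
rewrite big1 => [|[p1 p2] pp].
  by rewrite addr0; apply: eqmod_sym; apply: nf_mod.
rewrite (taft_coord_mon m_ge2 q_prim) ?ltn_pmod //=.
suff -> : ((i %% m)%N == p1) && (s == p2 :> nat) = false by rewrite scale0r.
apply: contra_neqF pp => /andP[/eqP e1 /eqP e2].
by congr (_, _); apply: val_inj.
Qed.

Lemma nf_section_scale a i s t j :
  nf_section (a *: single (d ^+ t * c ^+ j)%g (h ^+ i * x ^+ s)) ===
  a *: nf i s t j.
Proof.
rewrite -[a *: single _ _]addr0 nf_section_is_linear nf_section0 addr0.
apply: eqmodZ.
exact: nf_section_nf.
Qed.

Lemma nf_sectionM (Y : R) (v : B) :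
    (forall i s t j,
       Y * nf i s t j ===
       nf_section (v * single (d ^+ t * c ^+ j)%g (h ^+ i * x ^+ s))) ->
  forall b, Y * nf_section b === nf_section (v * b).
Proof.
move=> Yv; apply: skew_nf_ind => [a u w IHu IHw|i s t j].
  rewrite mulrDr -scalerAr !nf_section_is_linear mulrDr -scaleAr.
  by apply: eqmodD => //; apply: eqmodZ.
exact: eqmod_trans (eqmodMl _ (nf_section_nf _ _ _ _)) (Yv _ _ _ _).
Qed.

Lemma nf_section_H b : H * nf_section b === nf_section (hB * b).
Proof.
apply: nf_sectionM => i s t j; rewrite nf_mulH singleM hact1 mul1g mulrA -exprS.
exact/eqmod_sym/nf_section_nf.
Qed.

Lemma nf_section_X b : X * nf_section b === nf_section (xB * b).
Proof.
apply: nf_sectionM => i s t j; rewrite singleM hact1 mul1g mulrA.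
have -> : x * h ^+ i = q ^+ i *: (h ^+ i * x).
  by rewrite -{1}[x]expr1 (taft_xXh T_taft) mul1n.
rewrite -scalerAl -mulrA -exprS linearZ.
exact: eqmod_trans (nf_mulX scaleAr XH _ _ _ _)
  (eqmod_sym (nf_section_scale _ _ _ _ _)).
Qed.

Lemma nf_section_D b : D * nf_section b === nf_section (dB * b).
Proof.
apply: nf_sectionM => i s t j; rewrite singleM mul1r (hact_mon _ _ phi_d).
rewrite mulgA -expgS linearZ.
exact: eqmod_trans (nf_mulD scaleAr DH DX _ _ _ _)
  (eqmod_sym (nf_section_scale _ _ _ _ _)).
Qed.

Lemma nf_section_C b : C * nf_section b === nf_section (cB * b).
Proof.
apply: nf_sectionM => i s t j; rewrite singleM mul1r (hact_mon _ _ phi_c).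
rewrite mulgA -[c in (c * _ * _)%g]expg1 (Dlnk_cX gT_D) expn1.
rewrite -mulgA -expgD add1n linearZ.
exact: eqmod_trans (nf_mulC scaleAr CH CD CX _ _ _ _)
  (eqmod_sym (nf_section_scale _ _ _ _ _)).
Qed.

Lemma nf_section_1 : nf_section 1 === 1.
Proof.
have := nf_section_nf 0 0 0 0.
by rewrite /normal_form !expr0 !expg0 !mulr1 mulg1.
Qed.

End SectionMap.

(** [is_taft] prescribes the coproduct and the counit; the antipode axiom S(h) h = 1 then determines
    S(h). *)
Lemma taft_antipode_h : antipode h = h ^+ (m - 1).
Proof.
have [_ [ch _ counit_h _]] := T_taft.
have := antipodel h; rewrite ch tlift_tens; try by lin.
rewrite counit_h scale1r => /(congr1 (fun u => u * h ^+ (m - 1))).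
by rewrite mul1r -mulrA -exprS subn1 prednK // (taft_hm T_taft) mulr1.
Qed.

Lemma taft_antipode_x : antipode x = - (x * h ^+ (m - 1)).
Proof.
have [_ [_ cx _ counit_x]] := T_taft.
have := antipodel x; rewrite cx linearD /= !tlift_tens; try by lin.
rewrite counit_x scale0r antipode1 mul1r => /eqP; rewrite addr_eq0 => /eqP.
move/(congr1 (fun u => u * h ^+ (m - 1))).
by rewrite -mulrA -exprS subn1 prednK // (taft_hm T_taft) mulr1 mulNr.
Qed.

Let v := [tuple cB; dB; hB; xB].
Let rels := Tbs_relators m q k l n beta sigma.

Lemma skew_rels_eval0 : {in rels, forall p, nceval v p = 0}.
Proof.
have [_ _ cl dn cd] := gT_D.
have vc := nceval_var v 0; have vd := nceval_var v 1.
have vh := nceval_var v 2; have vx := nceval_var v 3.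
have v1 : nceval v 1 = 1 by rewrite rmorph1.
have E (u w : B) : u = w -> u - w = 0 by move->; rewrite subrr.
move=> p; rewrite !inE; do 9?[case/orP]; move=> /eqP->.
- rewrite (ncevalBE (ncevalXE l vc) v1); apply: E.
  by rewrite -[tnth v _]/cB single_eltX cl.
- rewrite (ncevalBE (ncevalXE n vd) v1); apply: E.
  by rewrite -[tnth v _]/dB single_eltX dn.
- rewrite (ncevalBE (ncevalXE m vh) v1); apply: E.
  by rewrite -[tnth v _]/hB single_oneX (taft_hm T_taft).
- rewrite (ncevalXE m vx) -[tnth v _]/xB single_oneX (taft_xm T_taft).
  by rewrite linear0.
- rewrite (ncevalBE (ncevalME vc vh) (ncevalME vh vc)); apply: E.
  by rewrite [LHS]singleM [RHS]singleM hact1 phi_h mulg1 mul1g mulr1 mul1r.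
- rewrite (ncevalBE (ncevalME vd vh) (ncevalME vh vd)); apply: E.
  by rewrite [LHS]singleM [RHS]singleM hact1 phi_h mulg1 mul1g mulr1 mul1r.
- rewrite (ncevalBE (ncevalME vc vd) (ncevalME (ncevalXE k vd) vc)); apply: E.
  rewrite -[tnth v 0]/cB -[tnth v 1]/dB single_eltX [LHS]singleM [RHS]singleM.
  by rewrite !hact_one cd.
- rewrite (ncevalBE (ncevalME vc vx) (ncevalZE beta (ncevalME vx vc))); apply: E.
  rewrite [LHS]singleM phi_c [tnth v 3 * _]singleM hact_one mulg1 mul1g mulr1.
  by rewrite mul1r linearZ.
- rewrite (ncevalBE (ncevalME vd vx) (ncevalZE sigma (ncevalME vx vd))); apply: E.
  rewrite [LHS]singleM phi_d [tnth v 3 * _]singleM hact_one mulg1 mul1g mulr1.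
  by rewrite mul1r linearZ.
- rewrite (ncevalBE (ncevalME vx vh) (ncevalZE q (ncevalME vh vx))); apply: E.
  rewrite [LHS]singleM [tnth v 2 * _]singleM !hact1 mulg1 (taft_xh T_taft).
  by rewrite linearZ.
Qed.

Lemma skew_presented : is_presented v rels.
Proof.
pose C := ncvar K (0 : 'I_4); pose D := ncvar K (1 : 'I_4).
pose H := ncvar K (2 : 'I_4); pose X := ncvar K (3 : 'I_4).
pose s := @nf_section _ C D H X.
have scAr := @free_scalerAr K 4.
(* Relators are designated by their position in [Tbs_relators]. *)
have mem i : (i < 10)%N -> in_ideal_gen rels (nth 0 rels i).
  by move=> i10; apply/ideal_mem/mem_nth.
have Cl : eqmod rels (C ^+ l) 1 by apply: (mem 0%N).
have Dn : eqmod rels (D ^+ n) 1 by apply: (mem 1%N).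
have Hm : eqmod rels (H ^+ m) 1 by apply: (mem 2%N).
have Xm : eqmod rels (X ^+ m) 0 by rewrite /eqmod subr0; apply: (mem 3%N).
have CH : eqmod rels (C * H) (H * C) by apply: (mem 4%N).
have DH : eqmod rels (D * H) (H * D) by apply: (mem 5%N).
have CD : eqmod rels (C * D) (D ^+ k * C) by apply: (mem 6%N).
have CX : eqmod rels (C * X) (beta *: (X * C)) by apply: (mem 7%N).
have DX : eqmod rels (D * X) (sigma *: (X * D)) by apply: (mem 8%N).
have XH : eqmod rels (X * H) (q *: (H * X)) by apply: (mem 9%N).
(* Gives surjectivity of the evaluation; the congruence [s_spec] below gives its kernel, since the
   section of 0 is 0. *)
have evs b : nceval v (s b) = b.
  rewrite [RHS]skewE linear_sum; apply: eq_bigr => g _.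
  rewrite [in RHS](taft_coordE m_ge2 T_taft (b g)) !linear_sum.
  apply: eq_bigr => p _; rewrite [RHS]linearZ; apply: ncevalZE.
  rewrite (ncevalME (ncevalME (ncevalME (ncevalXE _ (nceval_var v 2))
    (ncevalXE _ (nceval_var v 3))) (ncevalXE _ (nceval_var v 1)))
    (ncevalXE _ (nceval_var v 0))).
  rewrite [LHS]single_nf; congr (single _ _).
  exact: (Dlnk_codeK l_gt0 n_gt0 gT_D g).
have s_spec : forall p, eqmod rels p (s (nceval v p)).
  apply: free_ind => [a p r Pp Pr||i p Pp].
  - rewrite linearP; rewrite /s nf_section_is_linear.
    exact: (eqmodD (eqmodZ a Pp) Pr).
  - rewrite rmorph1; apply: eqmod_sym.
    exact: (nf_section_1 Cl Dn Hm Xm).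
  - apply: eqmod_trans (eqmodMl _ Pp) _.
    rewrite (ncevalME (nceval_var v i) (erefl _)).
    case: i => -[|[|[|[|i']]]] i4; last by case: (notF i4).
    + rewrite (_ : Ordinal i4 = 0); last exact: val_inj.
      exact: (nf_section_C scAr Cl Dn Hm Xm CH CD CX).
    + rewrite (_ : Ordinal i4 = 1); last exact: val_inj.
      exact: (nf_section_D scAr Cl Dn Hm Xm DH DX).
    + rewrite (_ : Ordinal i4 = 2); last exact: val_inj.
      exact: (nf_section_H scAr Cl Dn Hm Xm).
    + rewrite (_ : Ordinal i4 = 3); last exact: val_inj.
      exact: (nf_section_X scAr Cl Dn Hm Xm XH).
split=> [b|p]; first by exists (s b).
split=> [p0|]; last by apply: ideal_eval0; apply: skew_rels_eval0.
have := s_spec p; rewrite p0.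
rewrite /s nf_section0 /eqmod subr0; exact.
Qed.

Lemma skew_is_Tbs : is_Tbs m q k l n beta sigma cB dB hB xB.
Proof.
have [_ [ch cx counit_h counit_x]] := T_taft; have [_ _ cl dn _] := gT_D.
have inv g e : (0 < e)%N -> (g ^+ e = 1)%g -> (g^-1 = g ^+ (e - 1) :> gT)%g.
  by move=> e0 ge; apply: (mulIg g); rewrite mulVg -expgSr subn1 prednK.
split.
- exact: skew_presented.
- split; rewrite [LHS]skew_comul_single ?comul1 ?ch ?cx ?linearD /=.
  + by rewrite tlift_tens //; lin.
  + by rewrite tlift_tens //; lin.
  + by rewrite tlift_tens //; lin.
  + by rewrite !tlift_tens //; lin.
- by split; rewrite [LHS]skew_counit_single ?counit1.
- split; rewrite [LHS]skew_antipode_single ?invg1 ?hact1.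
  + by rewrite taft_antipode_h single_oneX.
  + by rewrite taft_antipode_x single_oneX singleM hact1 mulg1 linearN.
  + by rewrite antipode1 hact_one single_eltX (inv _ _ l_gt0 cl).
  + by rewrite antipode1 hact_one single_eltX (inv _ _ n_gt0 dn).
Qed.

End Presentation.

(** * The classification *)

Section MatchedPairExt.
Context {K : fieldType} {gT : finGroupType} {T : hopfAlgType K}.
Local Notation KG := (groupAlg K gT).

Lemma galg_tens_lfunP (W : vectType K) (f f' : 'Hom((KG \ox T)%type, W)) :
  (forall g a, f (gelt g \ox a) = f' (gelt g \ox a)) -> f = f'.
Proof.
move=> ff'; apply/lfunP => t; rewrite -[t]tlift_id !linear_tlift.
apply: eq_tlift => y a /=; move: y.
by apply: galg_linP => [||g]; [lin | lin | apply: ff'].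
Qed.

(** The axioms are propositions, so by proof irrelevance a matched pair is its two linear maps,
    which are determined by their values on the [gelt g \ox a]. *)
Lemma matchedPair_eq (mp mp' : matchedPair T KG) :
    (forall g a, gelt g |>[mp] a = gelt g |>[mp'] a) ->
    (forall g a, gelt g <|[mp] a = gelt g <|[mp'] a) ->
  mp = mp'.
Proof.
move=> /galg_tens_lfunP + /galg_tens_lfunP.
case: mp mp' => r s p1 p2 p3 p4 p5 p6 p7 [r' s' p1' p2' p3' p4' p5' p6' p7'] /=.
by move=> ss' rr'; case: _ / ss' in p1' p3' p5' p6' p7' *;
  case: _ / rr' in p2' p4' p5' p6' p7' *; f_equal; apply: proof_irrelevance.
Qed.

End MatchedPairExt.

(** Bezout without subtraction: gcd(a, b) + u b is a multiple of a for some natural u. *)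
Lemma expr_gcdn1 (R : pzRingType) (z : R) a b : (0 < a)%N ->
  z ^+ a = 1 -> z ^+ b = 1 -> z ^+ gcdn a b = 1.
Proof.
move=> a0 za zb; have [u _ /dvdnP[w E]] := Bezoutl b a0.
have : z ^+ (gcdn a b + u * b) = 1 by rewrite E mulnC exprM za expr1n.
by rewrite exprD mulnC exprM zb expr1n mulr1.
Qed.

Theorem theorem2p2 (K : fieldType) (m : nat) (q : K) (k l n : nat)
    (T : hopfAlgType K) (h x : T) (gT : finGroupType) (c d : gT)
    (m_ge2 : (2 <= m)%N) (q_prim : m.-primitive_root q)
    (k_gt0 : (0 < k)%N) (l_gt0 : (0 < l)%N) (n_gt0 : (0 < n)%N)
    (kl_mod_n : (k ^ l = 1 %[mod n])%N)
    (T_taft : is_taft m q h x) (gT_D : is_Dlnk k l n c d) :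
  (exists F : rootsOfUnity K l * rootsOfUnity K (gcdn n (k - 1)) ->
              matchedPair T (groupAlg K gT),
     bijective F /\
     forall (beta : rootsOfUnity K l)
            (sigma : rootsOfUnity K (gcdn n (k - 1))) (t i j' j : nat),
       (t < n)%N -> (i < l)%N -> (j' < m)%N -> (j < m)%N ->
       let g : groupAlg K gT := gelt (d ^+ t * c ^+ i)%g in
       let a : T := h ^+ j' * x ^+ j in
       g |>[F (beta, sigma)] a
         = (sval beta ^+ (i * j) * sval sigma ^+ (t * j)) *: a
       /\ g <|[F (beta, sigma)] a = counit a *: g)
  /\
  (forall mp : matchedPair T (groupAlg K gT),
     exists (beta : rootsOfUnity K l)
            (sigma : rootsOfUnity K (gcdn n (k - 1)))
            (B : hopfAlgType K) (cB dB hB xB : B),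
       is_Tbs m q k l n (sval beta) (sval sigma) cB dB hB xB /\
       hopf_isomorphic (bicrossed mp) (hopf_data B)).
Proof.
(* [rootsOfUnity] is unfolded so that the equality and choice structures of subtypes apply. *)
pose I :=
  ({z : K | l.-unity_root z} * {z : K | (gcdn n (k - 1)).-unity_root z})%type.
have bl (bs : I) : sval bs.1 ^+ l = 1 by apply/unity_rootP/(svalP bs.1).
have sg (bs : I) : sval bs.2 ^+ gcdn n (k - 1) = 1.
  exact/unity_rootP/(svalP bs.2).
pose chi (bs : I) := Dlnk_char l_gt0 n_gt0 gT_D (sval bs.1) (sval bs.2).
have chiE bs t i : chi bs (d ^+ t * c ^+ i)%g = sval bs.1 ^+ i * sval bs.2 ^+ t.
  exact: Dlnk_charE.
have chi1 bs : chi bs 1%g = 1 by exact: Dlnk_char1.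
have chiM bs g g' : chi bs (g * g')%g = chi bs g * chi bs g' by exact: Dlnk_charM.
have chic bs : chi bs c = sval bs.1.
  by have := chiE bs 0 1; rewrite expg0 mul1g expg1 expr1 expr0 mulr1.
have chid bs : chi bs d = sval bs.2.
  by have := chiE bs 1 0; rewrite expg0 mulg1 expg1 expr1 expr0 mul1r.
pose sc := taft_scale m_ge2 T_taft.
have scx b : sc b x = b *: x by exact: taft_scalex.
pose phi bs := taft_action m_ge2 q_prim T_taft (chi1 bs) (chiM bs).
pose F bs := act_matchedPair (phi bs).
have FlE bs g a : gelt g |>[F bs] a = sc (chi bs g) a by exact: act_lact_gelt.
have FrE bs g a : gelt g <|[F bs] a = counit a *: gelt g by exact: act_ractE.
have x0 := taft_x_neq0 m_ge2 q_prim T_taft.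
have surj mp : exists bs, F bs = mp.
  have [chi' [chi'1 chi'M lE rE]] := taft_matchedPair_char m_ge2 q_prim T_taft mp.
  have [_ _ cl dn cd] := gT_D.
  have chi'X g i : chi' (g ^+ i)%g = chi' g ^+ i.
    by elim: i => [|i IH]; rewrite ?expg0 ?expr0 // expgS exprS chi'M IH.
  have cl' : chi' c ^+ l = 1 by rewrite -chi'X cl.
  have dn' : chi' d ^+ n = 1 by rewrite -chi'X dn.
  have unit_neq0 (z : K) e : (0 < e)%N -> z ^+ e = 1 -> z != 0.
    move=> e0 ze; apply/eqP=> z0; move/eqP: ze.
    by rewrite z0 expr0n gtn_eqF // eq_sym oner_eq0.
  (* Applying the character to cd = d^k c gives chi'(d)^k = chi'(d) after cancelling chi'(c); one
     more factor chi'(d) is then cancelled. *)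
  have dk' : chi' d ^+ (k - 1) = 1.
    apply: (mulIf (unit_neq0 _ _ n_gt0 dn')); rewrite mul1r -exprSr subn1 prednK //.
    apply: (mulIf (unit_neq0 _ _ l_gt0 cl')).
    by rewrite -chi'X -chi'M -cd chi'M mulrC.
  have b_root : l.-unity_root (chi' c) by apply/unity_rootP.
  have s_root : (gcdn n (k - 1)).-unity_root (chi' d).
    exact/unity_rootP/expr_gcdn1.
  exists (exist (fun z => is_true (l.-unity_root z)) _ b_root,
    exist (fun z => is_true ((gcdn n (k - 1)).-unity_root z)) _ s_root).
  apply: matchedPair_eq => g a.
    rewrite FlE lE; congr (sc _ _).
    have [[t i] ->] := Dlnk_nf_surj l_gt0 n_gt0 gT_D g.
    by rewrite chiE chi'M !chi'X mulrC.
  by rewrite FrE rE.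
(* The inverse of [F] reads the two roots off the action of [c] and [d] on [x]; since [x] is nonzero
   they are determined. *)
pose chosen mp (bs : I) :=
  (gelt c |>[mp] x == sval bs.1 *: x) && (gelt d |>[mp] x == sval bs.2 *: x).
have F_chosen bs bs' : chosen (F bs) bs' = (bs' == bs).
  have xI (b b' : K) : (b *: x == b' *: x) = (b' == b).
    by rewrite -subr_eq0 -scalerBl scaler_eq0 (negPf x0) orbF subr_eq0 eq_sym.
  rewrite /chosen !FlE !scx chic chid !xI.
  by case: bs bs' => [b s] [b' s']; rewrite xpair_eqE -!val_eqE.
have ex mp : exists bs, chosen mp bs.
  by have [bs <-] := surj mp; exists bs; rewrite F_chosen.
have FK : cancel F (fun mp => xchoose (ex mp)).
  by move=> bs; apply/eqP; rewrite -F_chosen; apply: (xchooseP (ex _)).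
split.
  exists F; split; first by exists (fun mp => xchoose (ex mp)) => // mp;
    have [bs <-] := surj mp; rewrite FK.
  move=> beta sigma t i j' j _ _ _ _; split; last exact: FrE.
  by rewrite FlE chiE /sc taft_scale_mon exprMn -!exprM.
move=> mp; have [bs <-] := surj mp.
exists bs.1, bs.2, (skewGroupAlg (phi bs)), (single c 1), (single d 1),
  (single 1%g h), (single 1%g x); split.
  apply: (skew_is_Tbs m_ge2 q_prim l_gt0 n_gt0 kl_mod_n T_taft gT_D).
  - by move=> g; apply: taft_scaleh.
  - by rewrite -chic; apply: scx.
  - by rewrite -chid; apply: scx.
by apply: bicrossed_skew_isomorphic => g a; [apply: FlE | apply: FrE].
Qed.
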